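(* Let $X$ be a graph, $q\in\mathbb{R}$, $M=M_q(X)$, let $T=T(\omega,\eta)$ be a twin set in $X$, fix $u\in T$, and let $\theta=q\deg(u)+\omega-\eta$, an eigenvalue of $M$ with orthogonal eigenprojection $E_\theta$. Let $\mathcal{B}_1$ be the set obtained by orthonormalizing $\{\mathbf{e}_u-\mathbf{e}_v: v\in T\setminus\{u\}\}$, extend it to an orthonormal basis $\mathcal{B}=\mathcal{B}_1\cup\mathcal{B}_2$ of the $\theta$-eigenspace of $M$, and let $F=\sum_{\mathbf{w}\in\mathcal{B}_2}\mathbf{w}\mathbf{w}^T$ ($F=0$ if $\mathcal{B}_2=\varnothing$). Then $$|U_M(t)_{u,u}|\ \ge\ 2(E_\theta)_{u,u}-1\ =\ 1-\frac{2}{|T|}+2F_{u,u}\quad\text{for all } t,$$ with equality at a time $t$ if and only if $e^{it(\theta-\lambda)}=-1$ for every $\lambda\in\sigma_u(M)\setminus\{\theta\}$. Moreover: (1) Suppose $1-\frac{2}{|T|}+2F_{u,u}>0$. (a) If $\phi(M,t)\in\mathbb{Z}[t]$ and each vertex in $T$ is periodic, then each vertex in $T$ is tightly $C$-sedentary, where $C=1-\frac{2}{|T|}+2F_{u,u}$ whenever both of the following hold: (i) either all eigenvalues in $\sigma_u(M)$ are integers, or all of them are quadratic integers of the form $\frac12(a+b_j\sqrt{\Delta})$ with $a,b_j,\Delta$ integers, $a$ common to all, and $\Delta>1$ square-free; and (ii) the numbers $\nu_2\big(\frac{\lambda-\theta}{\sqrt{\Delta}}\big)$, for $\lambda\in\sigma_u(M)\setminus\{\theta\}$,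 are all equal (with $\Delta=1$ in the integer case); and $C>1-\frac{2}{|T|}+2F_{u,u}$ otherwise. (b) If no vertex in $T$ is periodic, then each vertex in $T$ is sharply $\big(1-\frac{2}{|T|}+2F_{u,u}\big)$-sedentary if and only if the following holds: whenever integers $m$ and $\ell_\lambda$ ($\lambda\in\sigma_u(M)\setminus\{\theta\}$) satisfy $m\theta+\sum_\lambda\ell_\lambda\lambda=0$ and $m+\sum_\lambda\ell_\lambda=0$, the integer $m$ is even. (2) If $|T|\ge 3$, then each vertex in $T$ is $\big(1-\frac{2}{|T|}+2F_{u,u}\big)$-sedentary. (3) If $T=\{u,v\}$ and there is an eigenvector $\mathbf{w}\notin\operatorname{span}\{\mathbf{e}_u-\mathbf{e}_v\}$ of $M$ associated with $\theta$ such that $\mathbf{w}^T\mathbf{e}_u\neq0$ or $\mathbf{w}^T\mathbf{e}_v\neq0$, then each vertex of $T$ is $2F_{u,u}$-sedentary.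
   Context: Graphs are undirected, with positive edge weights, possibly with loops, no multiple edges. $A(X)$ weighted adjacency matrix, $\deg(u)=2\omega_{u,u}+\sum_{j\ne u}\omega_{u,j}$, $D(X)$ diagonal degree matrix, $M_q(X)=qD(X)+A(X)$; $\phi(M,t)$ characteristic polynomial; $U_M(t)=e^{itM}$. $M=\sum_j\lambda_jE_j$ spectral decomposition; eigenvalue support $\sigma_u(M)=\{\lambda_j:E_j\mathbf{e}_u\neq0\}$. $u$ is periodic if $|U_M(\tau)_{u,u}|=1$ for some $\tau>0$. $u$ is $C$-sedentary ($0<C\le1$) if $\inf_{t>0}|U_M(t)_{u,u}|\ge C$; sharply $C$-sedentary if the infimum equals $C$; tightly $C$-sedentary if the infimum equals $C$ and is attained at some $t_0>0$. $\nu_2(a)$ is the exponent of the largest power of $2$ dividing $a$. Twins and twin sets: $u,v$ are twins if $N(u)\setminus\{u,v\}=N(v)\setminus\{u,v\}$, the edges $(u,w),(v,w)$ have equal weights, and loops on $u,v$ have equal weight (zero if absent); a twin set $T(\omega,\eta)$ is a maximal set of $\ge2$ pairwise twins, each with loop weight $\omega$, each pair joined by an edge of weight $\eta$ (weight $0$ meaning absent).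
   Formalization: In (1)(a), ''C > bound otherwise'' is proved when (i) holds or σ_u(M) is closed under algebraic conjugation (e.g. rational M). In (3), 2F_{u,u}-sedentary (with C>0) needs w_u+w_v≠0; otherwise only the infimum bound ≥2F_{u,u} is claimed. Both are false as literally stated. *)

(* Defs.v *)
(* MathComp / MathComp-Analysis, with the complex numbers R[i] of
   mathcomp-real-closed. *)
From HB Require Import structures.
From mathcomp Require Import all_boot all_order all_algebra.
From mathcomp Require Import complex.
From mathcomp Require Import all_classical all_reals all_analysis.

Set Implicit Arguments.
Unset Strict Implicit.
Unset Printing Implicit Defensive.

Import Order.TTheory GRing.Theory Num.Theory.
Import numFieldNormedType.Exports.

Local Open Scope ring_scope.

(* Undirected graphs on 'I_n, without multiple edges and with loops allowed.
   Edge weights are positive, so weight 0 encodes the absence of the edge. *)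
Record wgraph (R : realType) (n : nat) := WGraph {
  weight :> 'M[R]_n;
  weight_sym : weight^T = weight;
  weight_ge0 : forall i j, 0 <= weight i j }.

Section Graphs.
Variables (R : realType) (n : nat) (X : wgraph R n).

Definition neighbors (u : 'I_n) : {set 'I_n} := [set j | 0 < X u j]%SET.

Definition degree (u : 'I_n) : R := 2 * X u u + \sum_(j | j != u) X u j.

Definition twins (u v : 'I_n) : Prop :=
  [/\ neighbors u :\: [set u; v]%SET = neighbors v :\: [set u; v]%SET,
      forall w, w \in neighbors u :\: [set u; v]%SET -> X u w = X v w
    & X u u = X v v].

Definition twin_family (omega eta : R) (T : {set 'I_n}) : Prop :=
  [/\ (2 <= #|T|)%N,
      forall u, u \in T -> X u u = omega
    & forall u v, u \in T -> v \in T -> u != v ->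
        twins u v /\ X u v = eta].

Definition twin_set (omega eta : R) (T : {set 'I_n}) : Prop :=
  twin_family omega eta T /\
  forall S, twin_family omega eta S -> T \subset S -> S = T.

Definition deg_mx : 'M[R]_n := diag_mx (\row_j degree j).

Definition Mq (q : R) : 'M[R]_n := q *: deg_mx + X.

End Graphs.

Definition expmx (K : numFieldType) (n : nat) (A : 'M[K]_n) : 'M[K]_n :=
  limn (series (fun k : nat => k`!%:R^-1 *: A ^+ k)).

Definition expi (R : realType) (x : R) : R[i] := (cos x +i* sin x)%C.

Section QuantumWalk.
Variables (R : realType) (n : nat) (M : 'M[R]_n).

Definition transition (t : R) : 'M[R[i]]_n :=
  expmx ((0 +i* t)%C *: map_mx (real_complex R) M).

Definition amplitude (u : 'I_n) (t : R) : R :=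
  Normc.normc (transition t u u).

(* All matrices M below are symmetric, so row and column eigenvectors agree.
   kermx V^T is the orthogonal complement of the row space of V; the projection
   is 0 when lambda is not an eigenvalue. *)
Definition eigenproj (lambda : R) : 'M[R]_n :=
  let V := eigenspace M lambda in proj_mx V (kermx V^T).

Definition esupport (u : 'I_n) : set R :=
  [set lambda | eigenvalue M lambda /\
                eigenproj lambda *m delta_mx u (0 : 'I_1) != 0]%classic.

Definition periodic_vertex (u : 'I_n) : Prop :=
  exists2 tau : R, 0 < tau & amplitude u tau = 1.

Definition inf_amplitude (u : 'I_n) : R :=
  inf [set amplitude u t | t in [set t : R | 0 < t]]%classic.

Definition sedentary (C : R) (u : 'I_n) : Prop :=
  0 < C <= 1 /\ C <= inf_amplitude u.

Definition sharply_sedentary (C : R) (u : 'I_n) : Prop :=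
  0 < C <= 1 /\ inf_amplitude u = C.

Definition tightly_sedentary (C : R) (u : 'I_n) : Prop :=
  sharply_sedentary C u /\ exists2 t0 : R, 0 < t0 & amplitude u t0 = C.

End QuantumWalk.

Section OrthonormalFamilies.
Variables (R : realType) (n : nat).

Definition orthonormal_rows (k : nat) (B : 'M[R]_(k, n)) : Prop :=
  B *m B^T = 1%:M.

Definition twin_diff_space (T : {set 'I_n}) (u : 'I_n) : 'M[R]_n :=
  (\sum_(v in T :\ u) <<delta_mx (0 : 'I_1) u - delta_mx 0 v>>)%MS.

Definition sum_outer (k : nat) (B : 'M[R]_(k, n)) : 'M[R]_n :=
  \sum_(i < k) (row i B)^T *m row i B.

End OrthonormalFamilies.

Section Arithmetic.
Variable R : realType.

Definition square_free (d : nat) : Prop :=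
  forall p : nat, prime p -> ~~ (p ^ 2 %| d)%N.

(* Rational integers count as (degenerate) quadratic integers. *)
Definition quadratic_integer (x : R) : Prop :=
  exists b c : int, x ^+ 2 + b%:~R * x + c%:~R = 0.

(* Delta = 1 encodes the integer case. *)
Definition integral_form (S : set R) (Delta : nat) : Prop :=
  (Delta = 1%N /\ forall x, S x -> x \is a Num.int) \/
  [/\ (1 < Delta)%N, square_free Delta
    & exists a : int, forall x, S x ->
        quadratic_integer x /\
        exists b : int, x = 2^-1 * (a%:~R + b%:~R * Num.sqrt Delta%:R)].

Definition equal_val2 (S : set R) (theta : R) (Delta : nat) : Prop :=
  exists k : nat, forall x, S x -> x != theta ->
    exists2 c : int, (x - theta) / Num.sqrt Delta%:R = c%:~R
                   & logn 2 `|c|%N = k.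

(* Closure under algebraic conjugation over the rationals: y is a conjugate of
   x when every rational polynomial vanishing at x vanishes at y.  The
   eigenvalue supports of a real symmetric matrix with rational entries have
   this property; an integral characteristic polynomial does not ensure it. *)
Definition conj_closed (S : set R) : Prop :=
  forall x y : R, S x ->
    (forall p : {poly rat}, root (map_poly ratr p) x ->
                            root (map_poly ratr p) y) ->
    S y.

End Arithmetic.

(* Main.v *)
Require Import Defs.
From HB Require Import structures.
From mathcomp Require Import all_boot all_order all_algebra.
From mathcomp Require Import complex.
From mathcomp Require Import all_classical all_reals all_analysis.
From mathcomp Require Import ring lra zify.

Set Implicit Arguments.
Unset Strict Implicit.
Unset Printing Implicit Defensive.

Import Order.TTheory GRing.Theory Num.Theory.
Import numFieldNormedType.Exports.

Local Open Scope ring_scope.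

(* Write M = sum_a a E_a.  Then U(t)_uu = sum_a (E_a)_uu e^{ita} is a convex
   combination of characters, so its modulus is at least 2 (E_theta)_uu - 1, and
   it is close to this bound exactly when every e^{it(a - theta)} with a in the
   support of u, a <> theta, is close to -1.
   - E_theta splits as the projection onto the span of the twin differences,
     whose (u, u) entry is 1 - 1/|T|, plus F.
   - In the periodic case the infimum is a minimum over a compact period.  If
     the bound is attained at t0, the support lies in theta + Z (pi / t0); when
     the support is closed under conjugation, comparing the first two power sums
     of the conjugates of an irrational eigenvalue shows that (pi / t0)^2 is
     rational, which makes all eigenvalues in the support quadratic integers.
   - The arithmetic criterion in the aperiodic case is Kronecker's theorem with
     all target angles equal to pi.  It is proved by comparing the mean value of
     prod_j ((1 - cos (mu_j t)) / 2)^m, which decays polynomially in m by the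
     parity condition, with the exponentially small upper bound which would
     hold if the angles never came close to pi simultaneously. *)

(** * Orthogonal spectral decomposition of a real symmetric matrix *)

Section EigenProjections.
Variables (R : realType) (n : nat).

Lemma row_dot_eq0 (w : 'rV[R]_n) : (w *m w^T == 0) = (w == 0).
Proof.
apply/eqP/eqP => [w0|->]; last by rewrite mul0mx.
apply/rowP => j; rewrite mxE.
have := congr1 (fun A : 'M[R]_(1, 1) => A 0 0) w0; rewrite !mxE => /eqP.
rewrite psumr_eq0; last by move=> i _; rewrite mxE -expr2 sqr_ge0.
by move=> /allP /(_ j); rewrite mem_index_enum mxE mulf_eq0 orbb => /(_ isT)/eqP.
Qed.

(** If w = c V and w V^T = 0, then w w^T = w V^T c^T = 0, and a real row of norm 0 vanishes. *)
Lemma cap_orthogonal (V : 'M[R]_n) : (V :&: kermx V^T)%MS = 0.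
Proof.
apply/eqP; rewrite -submx0; apply/rV_subP => w.
rewrite sub_capmx => /andP[/submxP[c ->] /sub_kermxP wV0].
by rewrite submx0 -row_dot_eq0 trmx_mul mulmxA wV0 mul0mx.
Qed.

Lemma adds_orthogonal (V : 'M[R]_n) : (1%:M <= V + kermx V^T)%MS.
Proof.
rewrite sub1mx /row_full mxrank_disjoint_sum ?cap_orthogonal//.
by rewrite mxrank_ker mxrank_tr subnKC ?rank_leq_row.
Qed.

(** The complex spectral theorem applies to M as a Hermitian matrix. Its eigenvalues are real, and
    real matrices similar over the complex numbers are already similar over R. *)
Lemma symmetric_diagonalizable (M : 'M[R]_n) : M^T = M -> diagonalizable M.
Proof.
move=> Msym; pose MC := map_mx (real_complex R) M.
have MCreal : MC \is a mxOver Num.real.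
  by apply/mxOverP => i j; rewrite mxE complex_real.
have MCherm : MC \is hermsymmx.
  apply: realsym_hermsym => //; apply/is_hermitianmxP.
  by rewrite expr0 scale1r map_mx_id// /MC map_trmx Msym.
have dreal := hermitian_spectral_diag_real MCherm.
have /hermitian_normalmx/orthomx_spectralP specE := MCherm.
set P := spectralmx MC in specE; set d := spectral_diag MC in specE dreal.
have Punit : P \in unitmx := spectral_unit MC.
have sim : similar_in unitmx MC (diag_mx d).
  exists P => //; apply/similarP => //.
  by rewrite specE !mulmxA mulmxV// mul1mx.
have ddreal : diag_mx d \is a mxOver Num.real.
  apply/mxOverP => i j; rewrite mxE; case: eqP => _; rewrite ?mulr0n ?real0//.
  by rewrite mulr1n (mxOverP dreal).
have [Q] := real_similar sim MCreal ddreal.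
rewrite inE => /andP[Qreal Qunit] /(similarP Qunit) QE.
pose Q0 := map_mx (@complex.Re R) Q; pose d0 := map_mx (@complex.Re R) d.
have QQ0 : Q = map_mx (real_complex R) Q0.
  by apply/matrixP => i j; rewrite !mxE RRe_real// (mxOverP Qreal).
have dd0 : d = map_mx (real_complex R) d0.
  by apply/matrixP => i j; rewrite !mxE RRe_real// (mxOverP dreal).
have Q0unit : Q0 \in unitmx by rewrite -(map_unitmx (real_complex R)) -QQ0.
exists Q0 => //; apply/(diagonalizable_forLR Q0unit); exists d0.
apply/(similarLR Q0unit)/similarP => //.
apply: (@map_mx_inj _ _ (real_complex R)).
by rewrite !map_mxM -QQ0 map_diag_mx -dd0.
Qed.

Variable M : 'M[R]_n.
Hypothesis Msym : M^T = M.

Local Notation V := (eigenspace M).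
Local Notation E := (eigenproj M).

Lemma mul_eigenproj m (A : 'M[R]_(m, n)) a : (A <= V a)%MS -> A *m E a = A.
Proof. by move=> AV; rewrite proj_mx_id ?cap_orthogonal. Qed.

Lemma mul_eigenproj0 m (A : 'M[R]_(m, n)) a :
  A *m (V a)^T = 0 -> A *m E a = 0.
Proof.
by move=> /sub_kermxP AV; rewrite proj_mx_0 ?cap_orthogonal.
Qed.

Lemma eigenproj_sub a : (E a <= V a)%MS.
Proof. by rewrite -[E a]mul1mx proj_mx_sub. Qed.

Lemma eigenproj_compl a : (1%:M - E a) *m (V a)^T = 0.
Proof.
apply/sub_kermxP; rewrite -[X in (_ - X)]mul1mx.
by rewrite proj_mx_compl_sub// adds_orthogonal.
Qed.

(** The rows of 1 - E are orthogonal to the eigenspace, which contains the rows of E; so (1 - E) E^T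
    = 0, and E^T = E E^T is symmetric. *)
Lemma eigenproj_sym a : (E a)^T = E a.
Proof.
have EE : E a *m (E a)^T = (E a)^T.
  have /submxP[c Ec] := eigenproj_sub a.
  apply/eqP; rewrite eq_sym -subr_eq0 -{1}[(E a)^T]mul1mx -mulmxBl.
  by rewrite {2}Ec trmx_mul mulmxA eigenproj_compl mul0mx.
by have := congr1 trmx EE; rewrite trmx_mul trmxK EE.
Qed.

Lemma eigenprojM a : E a *m E a = E a.
Proof. by rewrite mul_eigenproj ?eigenproj_sub. Qed.

Lemma eigenproj_mul a : E a *m M = a *: E a.
Proof. exact/eigenspaceP/eigenproj_sub. Qed.

Lemma eigenspace_ortho a b : a != b -> V a *m (V b)^T = 0.
Proof.
move=> ab; have /eigenspaceP Va := submx_refl (V a).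
have /eigenspaceP Vb := submx_refl (V b).
have : V a *m M *m (V b)^T = V a *m (V b *m M)^T.
  by rewrite [(V b *m M)^T]trmx_mul Msym mulmxA.
rewrite Va Vb linearZ /= -scalemxAl -scalemxAr => /eqP.
rewrite -subr_eq0 -scalerBl scaler_eq0 subr_eq0 (negPf ab) /=.
by move=> /eqP.
Qed.

Lemma eigenproj_neq m (A : 'M[R]_(m, n)) a b :
  a != b -> (A <= V a)%MS -> A *m E b = 0.
Proof.
move=> ab /submxP[c ->]; rewrite -mulmxA mul_eigenproj0 ?mulmx0//.
exact: eigenspace_ortho.
Qed.

(** A diagonal entry of a symmetric idempotent is the squared norm of its row. This makes the
    weights nonnegative and turns membership in the eigenvalue support into a scalar condition. *)
Lemma eigenproj_diagE a v : E a v v = \sum_j (E a v j) ^+ 2.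
Proof.
rewrite -{1}eigenprojM mxE; apply: eq_bigr => j _.
by rewrite expr2 -[in E a j v]eigenproj_sym [(E a)^T _ _]mxE.
Qed.

Lemma eigenproj_diag_ge0 a v : 0 <= E a v v.
Proof. by rewrite eigenproj_diagE sumr_ge0// => j _; rewrite sqr_ge0. Qed.

Lemma eigenproj_col_eq0 a v :
  (E a *m delta_mx v (0 : 'I_1) == 0) = (E a v v == 0).
Proof.
rewrite -colE; apply/eqP/eqP => [/matrixP/(_ v 0)|]; first by rewrite !mxE.
rewrite eigenproj_diagE => /eqP; rewrite psumr_eq0 => [/allP Ev|j _]; last first.
  exact: sqr_ge0.
apply/colP => i; rewrite [LHS]mxE [RHS]mxE.
have := Ev i; rewrite mem_index_enum sqrf_eq0 => /(_ isT)/eqP <-.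
by rewrite -[in LHS]eigenproj_sym [(E a)^T _ _]mxE.
Qed.

Lemma eigenproj_eq0 a : (E a == 0) = ~~ eigenvalue M a.
Proof.
rewrite negbK; apply/eqP/eqP => [E0|V0]; last first.
  by apply/eqP; rewrite -submx0 -V0 eigenproj_sub.
by rewrite -[V a](mul_eigenproj (submx_refl _)) E0 mulmx0.
Qed.

Lemma esupportE v a : esupport M v a <-> E a v v != 0.
Proof.
split=> [[_]|Ev]; first by rewrite eigenproj_col_eq0.
split; last by rewrite eigenproj_col_eq0.
by apply: contraNT Ev; rewrite -eigenproj_eq0 => /eqP ->; rewrite mxE.
Qed.

(** The sum of the projections fixes each eigenspace, since the other projections vanish there, and
    the eigenspaces span the whole space. *)
Lemma spectral_resolution :
  exists2 rs : seq R, uniq rs & \sum_(a <- rs) E a = 1%:M.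
Proof.
have /diagonalizablePeigen[rs urs rsP] := symmetric_diagonalizable Msym.
exists rs => //; apply/eqP; rewrite -subr_eq0 -submx0.
suff: (1%:M <= kermx (\sum_(a <- rs) E a - 1%:M))%MS.
  by move=> /sub_kermxP; rewrite mul1mx => ->.
rewrite -rsP (big_nth 0) big_mkord; apply/sumsmx_subP => i _.
apply/sub_kermxP; rewrite mulmxBr mulmx1 mulmx_sumr.
rewrite (bigD1_seq rs`_i) ?mem_nth//= mul_eigenproj ?submx_refl//.
rewrite big1 ?addr0 ?subrr// => a ai.
by rewrite (@eigenproj_neq _ _ rs`_i)// eq_sym.
Qed.

Variable rs : seq R.
Hypothesis rs_uniq : uniq rs.
Hypothesis rsE : \sum_(a <- rs) E a = 1%:M.

Lemma mem_resolution a : eigenvalue M a -> a \in rs.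
Proof.
rewrite -[eigenvalue _ _]negbK -eigenproj_eq0; apply: contraNT => ars.
rewrite -[E a]mulmx1 -rsE mulmx_sumr big1_seq// => b /andP[_ brs].
rewrite (@eigenproj_neq _ _ a) ?eigenproj_sub//.
by apply: contraNneq ars => ->.
Qed.

Lemma sum_eigenproj_diag v : \sum_(a <- rs) E a v v = 1.
Proof.
have := congr1 (fun A : 'M[R]_(n, n) => A v v) rsE.
by rewrite summxE mxE eqxx mulr1n.
Qed.

End EigenProjections.

(** * Spectral expansion of the matrix exponential *)

Section ComplexExponential.
Variable R : realType.
Implicit Types (x y t : R) (z : R[i]).
Local Notation C := (Num.NumField.sort (R[i] : numFieldType)).

Lemma normc_real x : Normc.normc (x%:C)%C = `|x|.
Proof. by rewrite /= expr0n /= addr0 sqrtr_sqr. Qed.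

Lemma normr_normc z : `|z| = ((Normc.normc z)%:C)%C.
Proof. by []. Qed.

Lemma eq_ReIm z w : complex.Re z = complex.Re w -> complex.Im z = complex.Im w -> z = w.
Proof. by move=> re im; apply/eqP; rewrite eq_complex re im !eqxx. Qed.

Lemma cvg_complex (f g : nat -> R) x y :
  (f @ \oo --> x)%classic -> (g @ \oo --> y)%classic ->
  ((fun k => (f k +i* g k)%C : C) @ \oo --> ((x +i* y)%C : C))%classic.
Proof.
move=> fx gy; apply/cvgrPdist_lt => e.
case: e => e e'; rewrite ltcE /= => /andP[/eqP -> e0].
have e20 : 0 < e / 2 by rewrite divr_gt0.
near=> k.
have -> : (x +i* y - (f k +i* g k) = (x - f k)%:C + 'i * (y - g k)%:C)%C.
  by apply: eq_ReIm => /=; ring.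
rewrite (le_lt_trans (ler_normD _ _))// normrM [`|'i%C|]normc_def /=.
rewrite expr0n expr1n add0r sqrtr1 mul1r !normr_normc !normc_real -rmorphD /= ltcR.
rewrite [e]splitr ltrD//; near: k.
  by move/cvgrPdist_lt: fx; apply.
by move/cvgrPdist_lt: gy; apply.
Unshelve. all: end_near. Qed.

Lemma imaginary_pow x k :
  ((0 +i* x)%C : R[i]) ^+ k / k`!%:R = (cos_coeff x k +i* sin_coeff x k)%C.
Proof.
have step j : ((0 +i* x)%C : R[i]) ^+ j.*2 = (((-1) ^+ j * x ^+ j.*2)%:C)%C.
  rewrite -muln2 mulnC !exprM -exprMn_comm; last exact: mulrC.
  rewrite [RHS]rmorphXn; congr (_ ^+ j); apply: eq_ReIm => /=; ring.
have factE m : (m`!%:R : R[i])^-1 = ((m`!%:R^-1)%:C)%C.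
  by rewrite fmorphV /= rmorph_nat.
(* Even powers of ix are real and odd ones imaginary, so k is split by parity. *)
have [b [j ->]] : exists b : bool, exists j, k = (b + j.*2)%N.
  by exists (odd k), k./2; rewrite odd_double_half.
rewrite factE /cos_coeff /sin_coeff /= !oddD odd_double addbF oddb exprD step.
rewrite half_bit_double; apply: eq_ReIm; case: b;
  rewrite /= ?doubleK ?add0n ?exprS ?expr0 -?exprnP /=; ring.
Qed.

Lemma cvg_expi x :
  (series (fun k => k`!%:R^-1 * ((0 +i* x)%C : C) ^+ k) @ \oo --> (expi x : C))%classic.
Proof.
have -> : series (fun k => k`!%:R^-1 * ((0 +i* x)%C : R[i]) ^+ k) =
    (fun n => (series (cos_coeff x) n +i* series (sin_coeff x) n)%C).
  apply/funext => n; rewrite /series /=; elim: n => [|n IHn].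
    by rewrite !big_geq.
  by rewrite !big_nat_recr//= IHn mulrC imaginary_pow.
apply: cvg_complex.
  by have := @is_cvg_series_cos_coeff R x; rewrite unlock.
by have := @is_cvg_series_sin_coeff R x; rewrite unlock.
Qed.

Lemma expiD x y : expi (x + y) = expi x * expi y.
Proof.
by apply: eq_ReIm; rewrite /= ?cosD ?sinD; ring.
Qed.

Lemma expi0 : expi 0 = 1 :> R[i].
Proof. by rewrite /expi cos0 sin0. Qed.

Lemma normc_expi x : Normc.normc (expi x) = 1.
Proof. by rewrite /= cos2Dsin2 sqrtr1. Qed.

Lemma expi_eqN1 x : (expi x = -1) <-> (cos x = -1).
Proof.
split=> [[]//|cx]; apply/eqP; rewrite eq_complex /= cx eqxx /= oppr0.
by apply/eqP/cos1sin0; rewrite cx normrN1.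
Qed.

(** Every partial sum of the exponential series already decomposes along the projections, so the
    matrix limit reduces to finitely many scalar limits. *)
Lemma transitionE n (M : 'M[R]_n) (rs : seq R) t : M^T = M -> uniq rs ->
  \sum_(a <- rs) eigenproj M a = 1%:M ->
  transition M t =
    \sum_(a <- rs) expi (t * a) *: map_mx (real_complex R) (eigenproj M a).
Proof.
move=> Msym urs rsE; rewrite /transition /expmx.
set A := _ *: map_mx _ M.
have powE k : A ^+ k = \sum_(a <- rs)
    ((0 +i* (t * a))%C ^+ k) *: map_mx (real_complex R) (eigenproj M a).
  elim: k => [|k IHk].
    under eq_bigr do rewrite expr0 scale1r.
    by rewrite expr0 -raddf_sum /= rsE map_mx1.
  rewrite exprSr IHk -mulmxE mulmx_suml; apply: eq_bigr => a _.
  rewrite -scalemxAl -scalemxAr -map_mxM eigenproj_mul// map_mxZ !scalerA.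
  rewrite exprSr; congr (_ * _ *: _).
  by apply: eq_ReIm => /=; ring.
have -> : series (fun k => k`!%:R^-1 *: A ^+ k) = (fun N => \sum_(a <- rs)
    series (fun k => k`!%:R^-1 * ((0 +i* (t * a))%C : R[i]) ^+ k) N *:
      map_mx (real_complex R) (eigenproj M a)).
  apply/funext => N; rewrite /series /=; under eq_bigr do rewrite powE scaler_sumr.
  rewrite exchange_big /=; apply: eq_bigr => a _; rewrite scaler_suml.
  by apply: eq_bigr => k _; rewrite scalerA.
apply: (@cvg_lim 'M[C]_n (@norm_hausdorff C 'M[C]_n)).
apply: (@cvg_big 'M[C]_n) => [|a _]; first exact: add_continuous.
by apply: cvgZr_tmp; exact: cvg_expi.
Qed.

Lemma amplitudeE n (M : 'M[R]_n) (rs : seq R) v t : M^T = M -> uniq rs ->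
  \sum_(a <- rs) eigenproj M a = 1%:M ->
  amplitude M v t =
    Normc.normc (\sum_(a <- rs) ((eigenproj M a v v)%:C)%C * expi (t * a)).
Proof.
move=> Msym urs rsE; rewrite /amplitude (transitionE _ Msym urs rsE) summxE.
by congr Normc.normc; apply: eq_bigr => a _; rewrite mxE [_ v v]mxE mulrC.
Qed.

End ComplexExponential.

(** * Mean values of trigonometric sums *)

Section Kronecker.
Variable R : realType.

Lemma is_derive_sum_seq (I : Type) (r : seq I) (f df : I -> R -> R) (x : R) :
  (forall i, is_derive x 1 (f i) (df i x)) ->
  is_derive x 1 (fun t => \sum_(i <- r) f i t) (\sum_(i <- r) df i x).
Proof.
move=> fdf; elim: r => [|i r IHr].
  under eq_fun do rewrite big_nil.
  by rewrite big_nil; exact: is_derive_cst.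
under eq_fun do rewrite big_cons.
by rewrite big_cons; apply: is_deriveD.
Qed.

(** The primitive of cos (nu t) that vanishes at 0. Frequency 0 is the only one with linear growth,
    and dividing by it would give 0 by convention. *)
Definition cos_primitive (nu t : R) : R :=
  if nu == 0 then t else sin (nu * t) / nu.

Lemma is_derive_cos_primitive (nu x : R) :
  is_derive x 1 (cos_primitive nu) (cos (nu * x)).
Proof.
rewrite /cos_primitive; have [->|nu0] := eqVneq nu 0.
  by rewrite mul0r cos0; exact: is_derive_id.
have d1 : is_derive x 1 (fun t => nu * t) nu.
  have := @is_deriveZ _ _ _ id nu x 1 1 (is_derive_id _ _).
  by rewrite /GRing.scale/= mulr1.
have H := @is_deriveZ _ _ _ (sin \o (fun t => nu * t)) nu^-1 x 1 _
  (@is_derive1_comp _ _ _ _ _ _ (is_derive_sin (nu * x)) d1).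
under eq_fun do rewrite mulrC.
by apply: (@is_derive_eq _ _ _ _ _ _ _ _ H); rewrite /GRing.scale/= mulrCA mulVf ?mulr1.
Qed.

(* The primitive of a nonnegative function is nondecreasing, whereas the
   oscillating terms of the primitive stay bounded. *)
Lemma mean_le (I : finType) (c nu : I -> R) (B : R) :
  (forall t, 0 < t -> \sum_i c i * cos (nu i * t) <= B) ->
  \sum_(i | nu i == 0) c i <= B.
Proof.
move=> cB; rewrite leNgt; apply/negP => Blt.
pose h i (t : R) := c i * cos (nu i * t).
pose H (t : R) := B * t - \sum_i c i * cos_primitive (nu i) t.
have dH (x : R) : is_derive x 1 H (B - \sum_i h i x).
  apply: is_deriveB.
    have := @is_deriveZ _ _ _ id B x 1 1 (is_derive_id _ _).
    by rewrite /GRing.scale/= mulr1.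
  apply: is_derive_sum_seq => i; apply: is_deriveZ.
  exact: is_derive_cos_primitive.
pose S := \sum_(i | nu i == 0) c i.
pose D := \sum_i `|c i / nu i|.
have D0 : 0 <= D by rewrite sumr_ge0.
(* At this time the linear part (S - B) t equals D + 1, while the oscillating part is at most D in
   absolute value; hence H t < 0. *)
pose t := (D + 1) / (S - B).
have SB : 0 < S - B by rewrite subr_gt0.
have t0 : 0 < t by rewrite divr_gt0// ltr_wpDl.
have Hc : {within `[0, t], continuous H}%classic.
  by apply: derivable_within_continuous => x _; have [] := dH x.
have [x] := MVT t0 (fun x _ => dH x) Hc.
rewrite in_itv /= => /andP[x0 xt].
have H0 : H 0 = 0.
  rewrite /H mulr0 big1 ?subrr// => i _.
  by rewrite /cos_primitive mulr0 sin0 mul0r if_same mulr0.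
rewrite H0 !subr0 => Ht.
have {Ht} : 0 <= H t by rewrite Ht mulr_ge0 ?(ltW t0)// subr_ge0 cB.
apply/negP; rewrite -ltNge /H (bigID (fun i => nu i == 0)) /=.
have -> : \sum_(i | nu i == 0) c i * cos_primitive (nu i) t = S * t.
  by rewrite mulr_suml; apply: eq_bigr => i nui; rewrite /cos_primitive nui.
set Q := \sum_(i | _) _.
have : `|Q| <= D.
  rewrite /D (bigID (fun i => nu i == 0)) /= ler_wpDl ?sumr_ge0//.
  apply: le_trans (ler_norm_sum _ _ _) _; apply: ler_sum => i nui.
  rewrite /cos_primitive (negPf nui) mulrCA normrM ler_piMl//.
  exact: sin_max.
have -> : B * t = S * t - (D + 1).
  by rewrite -[D + 1](divfK (lt0r_neq0 SB)) -/t; ring.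
rewrite ler_norml => /andP[Q1 _]; lra.
Qed.

End Kronecker.

(** * Kronecker's theorem with all target angles equal to pi *)

Section KroneckerTheorem.
Variable R : realType.
Local Notation toC := (real_complex R).

(** The central coefficient is the largest of 2m+1 coefficients with sum 4^m. The induction rests on
    (m+1) C(2m+2, m+1) = 2 (2m+1) C(2m, m). *)
Lemma central_binomial_ge m : (4 ^ m <= m.*2.+1 * 'C(m.*2, m))%N.
Proof.
elim: m => // m IHm; rewrite doubleS.
have := mul_bin_diag m.*2.+2 m; have := mul_bin_down m.*2.+1 m.
have -> : (m.*2.+1 - m = m.+1)%N by lia.
rewrite /= expnS.
set b := 'C(m.*2, m) in IHm *; set b1 := 'C(_, m); set b2 := 'C(_, m.+1).
move: IHm; rewrite -!muln2; nia.
Qed.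

(** With e = 1 - q, Bernoulli's inequality and q (1 + e) <= 1 give q^M <= 1 / (M e). For m = M (k+1)
    this yields the power k+1 of M in the denominator, against M^k in the numerator, so M > [A]
    suffices. *)
Lemma exponential_beats_polynomial (k : nat) (q : R) : 0 <= q < 1 ->
  exists m : nat, (m.*2.+1)%:R ^+ k * q ^+ m < 1.
Proof.
move=> /andP[q0 q1]; pose e := 1 - q.
have e0 : 0 < e by rewrite subr_gt0.
pose A : R := (k.*2 + 3)%:R ^+ k / e ^+ k.+1.
have A0 : 0 <= A by rewrite divr_ge0// ?exprn_ge0// ltW.
have [M AM] : exists M : nat, A < M%:R.
  by exists (Num.bound A); exact: archi_boundP.
have M0 : (0 < M)%N by rewrite -(ltr_nat R) (le_lt_trans A0).
exists (M * k.+1)%N.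
have qM : q ^+ M * (M%:R * e) <= 1.
  have H : (1 + e *+ M) <= (1 + e) ^+ M.
    elim: (M) => [|j IHj]; first by rewrite mulr0n addr0 expr0.
    rewrite exprS; apply: le_trans (ler_wpM2l _ IHj); last lra.
    rewrite mulrS mulrDr mulr1 mulrDl mul1r.
    have : 0 <= e * (e *+ j) by rewrite mulr_ge0 ?mulrn_wge0 ?ltW.
    lra.
  have : q ^+ M * (1 + e) ^+ M <= 1.
    by rewrite -exprMn exprn_ile1// /e; nra.
  apply: le_trans; apply: ler_wpM2l; first exact: exprn_ge0.
  by apply: le_trans H; rewrite mulr_natl lerDr.
have Me0 : 0 < M%:R * e by rewrite mulr_gt0// ltr0n.
have qMk : q ^+ (M * k.+1) <= (M%:R * e) ^- k.+1.
  rewrite exprM -exprVn lerXn2r ?nnegrE ?exprn_ge0 ?invr_ge0 ?(ltW Me0)//.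
  by rewrite -[leRHS]mul1r ler_pdivlMr.
have P : ((M * k.+1).*2.+1)%:R ^+ k <= (M%:R * (k.*2 + 3)%:R) ^+ k :> R.
  rewrite lerXn2r ?nnegrE ?mulr_ge0 ?ler0n// -natrM ler_nat -!muln2; nia.
apply: le_lt_trans (ler_pM _ _ P qMk) _; rewrite ?exprn_ge0//.
rewrite ltr_pdivrMr ?exprn_gt0// mul1r !exprMn exprS -mulrA mulrCA.
rewrite ltr_pM2l ?exprn_gt0 ?ltr0n//.
by move: AM; rewrite /A ltr_pdivrMr ?exprn_gt0.
Qed.

(* Coefficients of (2 - 2 cos x)^m = (-1)^m e^{-imx} (1 - e^{ix})^{2m}. *)
Definition kernel_coef (m : nat) (j : 'I_(m.*2.+1)) : R :=
  (-1) ^+ (j + m) * 'C(m.*2, j)%:R.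

Lemma expi_mulrn (x : R) j : expi (x *+ j) = expi x ^+ j.
Proof.
elim: j => [|j IHj]; first by rewrite mulr0n expi0.
by rewrite mulrS expiD IHj exprS.
Qed.

Lemma expi_nat (x : R) j : expi (j%:R * x) = expi x ^+ j.
Proof. by rewrite mulr_natl expi_mulrn. Qed.

Lemma kernel_expand (m : nat) (x : R) :
  toC ((2 - 2 * cos x) ^+ m) =
  \sum_(j < m.*2.+1) toC (kernel_coef j) * expi ((j%:R - m%:R) * x).
Proof.
(* For m = 1 this reads e^{ix} (2 - 2 cos x) = - (1 - e^{ix})^2. *)
have E1 : expi x ^+ m * toC ((2 - 2 * cos x) ^+ m) =
    (-1) ^+ m * (1 - expi x) ^+ m.*2.
  rewrite rmorphXn -exprMn -muln2 mulnC exprM -exprMn; congr (_ ^+ m).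
  by rewrite expr2; apply: eq_ReIm => /=; have := cos2Dsin2 x; nra.
have E0 : expi x ^+ m * expi (- (m%:R * x)) = 1.
  by rewrite -expi_nat -expiD subrr expi0.
rewrite -[LHS]mul1r -E0 mulrAC E1 mulrAC.
rewrite [(1 - _) ^+ _]exprBn_comm; last by rewrite /GRing.comm mulr1 mul1r.
rewrite big_distrr /=; apply: eq_bigr => j _.
rewrite expr1n mulr1 /kernel_coef mulrBl expiD expi_nat.
rewrite rmorphM rmorphXn rmorphN1 rmorph_nat exprD -mulr_natr.
by ring.
Qed.

Variables (I : finType) (mu : I -> R).

(** Expanding the product picks one exponential per factor, so the terms are indexed by functions
    [f]. The coefficients are real, and real parts turn the exponentials into cosines. *)
Lemma kernel_prod_expand (m : nat) (t : R) :
  \prod_i (2 - 2 * cos (mu i * t)) ^+ m =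
  \sum_(f : {ffun I -> 'I_(m.*2.+1)})
    (\prod_i kernel_coef (f i)) * cos ((\sum_i ((f i)%:R - m%:R) * mu i) * t).
Proof.
have expi_sum (F : I -> R) : \prod_i expi (F i) = expi (\sum_i F i).
  elim/big_rec2: _ => [|i y1 y2 _ ->]; first by rewrite expi0.
  by rewrite expiD.
have Re_sum (J : finType) (F : J -> R[i]) :
    complex.Re (\sum_j F j) = \sum_j complex.Re (F j).
  by elim/big_rec2: _ => [//|j y1 y2 _ <-]; case: (F j) y2 => ? ? [].
have CE : toC (\prod_i (2 - 2 * cos (mu i * t)) ^+ m) =
    \sum_(f : {ffun I -> 'I_(m.*2.+1)}) toC (\prod_i kernel_coef (f i)) *
      expi ((\sum_i ((f i)%:R - m%:R) * mu i) * t).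
  rewrite rmorph_prod.
  rewrite (eq_bigr _ (fun i _ => kernel_expand m (mu i * t))).
  rewrite bigA_distr_bigA /=; apply: eq_bigr => f _.
  rewrite big_split /= expi_sum -rmorph_prod mulr_suml.
  by congr (_ * expi _); apply: eq_bigr => i _; rewrite mulrA.
rewrite -[LHS]/(complex.Re (toC _)) CE Re_sum; apply: eq_bigr => f _ /=.
by rewrite mul0r subr0.
Qed.

Theorem kronecker_pi :
  (forall l : I -> int, \sum_i (l i)%:~R * mu i = 0 -> (2 %| \sum_i l i)%Z) ->
  forall e, 0 < e -> exists2 t, 0 < t & forall i, cos (mu i * t) < -1 + e.
Proof.
move=> even_rel e e0; apply: contrapT => Nt.
(* This keeps the ratio [q] = 1 - e/2 nonnegative. *)
wlog e1 : e e0 Nt / e <= 1.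
  move=> H; have [|e1] := leP e 1; first exact: H.
  apply: (H 1) => //; apply: contra_not Nt => -[t t0 ct]; exists t => // i.
  by apply: lt_trans (ct i) _; rewrite ltrD2l.
pose q := 1 - e / 2.
have [m] : exists m : nat, (m.*2.+1)%:R ^+ #|I| * q ^+ m < 1.
  by apply: exponential_beats_polynomial; apply/andP; split; rewrite /q; lra.
apply/negP; rewrite -leNgt.
(* By assumption some cosine is at least -1 + e at every time; its factor is at most 4 - 2e = 4q,
   and each other factor is at most 4. *)
have K_le t : 0 < t ->
    \prod_i (2 - 2 * cos (mu i * t)) ^+ m <= 4 ^+ (#|I| * m) * q ^+ m.
  move=> t0; have [i0 ci0] : exists i, -1 + e <= cos (mu i * t).
    apply: contrapT => Ni; apply: Nt; exists t => // i.
    by rewrite ltNge; apply/negP => ci; apply: Ni; exists i.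
  have c01 i : 0 <= 2 - 2 * cos (mu i * t) <= 4.
    by have := cos_geN1 (mu i * t); have := cos_le1 (mu i * t); lra.
  rewrite (bigD1 i0) //= mulrC.
  have -> : (#|I| * m = m * #|predC1 i0| + m)%N.
    have -> : #|I| = #|predC1 i0|.+1.
      by rewrite cardC1 prednK//; apply/card_gt0P; exists i0.
    by rewrite mulSn addnC mulnC.
  rewrite exprD -mulrA; apply: ler_pM.
  - by apply: prodr_ge0 => i _; rewrite exprn_ge0; case/andP: (c01 i).
  - by rewrite exprn_ge0; case/andP: (c01 i0).
  - rewrite exprM -prodr_const; apply: ler_prod => i _.
    by case/andP: (c01 i) => c0 c4; rewrite exprn_ge0//= lerXn2r ?nnegrE.
  - have q0 : 0 <= q by rewrite /q; lra.
    rewrite -exprMn lerXn2r ?nnegrE ?mulr_ge0//; have := c01 i0; rewrite /q; lra.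
have le_mean : \sum_(f : {ffun I -> 'I_(m.*2.+1)} | \sum_i ((f i)%:R - m%:R) * mu i == 0)
    \prod_i kernel_coef (f i) <= 4 ^+ (#|I| * m) * q ^+ m.
  by apply: mean_le => t t0; rewrite -kernel_prod_expand; exact: K_le.
(* A zero frequency is a relation with coefficients f i - m. Their sum is even by hypothesis, so the
   sign (-1)^(sum of f i + m) is positive. *)
have coef_ge0 (f : {ffun I -> 'I_(m.*2.+1)}) :
    \sum_i ((f i)%:R - m%:R) * mu i == 0 -> 0 <= \prod_i kernel_coef (f i).
  move=> /eqP fmu; have := even_rel (fun i => (f i)%:Z - m%:Z).
  move=> ev; have {}ev := ev (etrans (eq_bigr _ (fun i _ =>
    congr1 (fun z => z * mu i) (intrB R (f i)%:Z m%:Z))) fmu).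
  rewrite /kernel_coef big_split /=;
  apply: mulr_ge0; last by apply: prodr_ge0.
  rewrite prodrXr -signr_odd; suff -> : odd (\sum_i (f i + m)) = false by [].
  apply/negbTE; rewrite -dvdn2 -[(_ %| _)%N]/(2%:Z %| (\sum_i (f i + m))%N%:Z)%Z.
  have -> : (\sum_i (f i + m))%N%:Z = \sum_i ((f i)%:Z - m%:Z) + 2 * \sum_(i : I) m%:Z.
    rewrite mulr_sumr -big_split /= -natz natr_sum; apply: eq_bigr => i _; lia.
  by rewrite rpredD// dvdz_mulr.
(* The constant function m has frequency 0 and coefficient C(2m, m)^|I|; the other terms of
   frequency 0 are nonnegative and may be dropped. *)
pose f0 : {ffun I -> 'I_(m.*2.+1)} := [ffun=> inord m].
have f0m i : f0 i = m :> nat by rewrite ffunE inordK// -addnn ltnS leq_addr.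
have le1 := le_mean; rewrite (bigD1 f0) /= in le1; last first.
  by rewrite big1// => i _; rewrite f0m subrr mul0r.
have {}le1 : ('C(m.*2, m)%:R) ^+ #|I| <= 4 ^+ (#|I| * m) * q ^+ m :> R.
  apply: le_trans le1; rewrite [in leRHS]addrC ler_wpDl//.
    by apply: sumr_ge0 => f /andP[/coef_ge0].
  rewrite -prodr_const; apply: ler_prod => i _; rewrite /kernel_coef f0m.
  by rewrite addnn -signr_odd odd_double expr0 mul1r ler0n lexx.
have C0 : 0 < 'C(m.*2, m)%:R ^+ #|I| :> R.
  by rewrite exprn_gt0// ltr0n bin_gt0 -addnn leq_addr.
(* Bounding 4^m by (2m+1) C(2m, m) and cancelling C(2m, m)^|I| contradicts the choice of [m]. *)
rewrite -(ler_pM2l C0) mulr1; apply: le_trans le1 _.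
rewrite mulrA; apply: ler_wpM2r; first by rewrite exprn_ge0// /q; lra.
rewrite -exprMn mulnC exprM lerXn2r ?nnegrE ?exprn_ge0 ?mulr_ge0//.
by rewrite -natrX -natrM ler_nat mulnC central_binomial_ge.
Qed.

End KroneckerTheorem.

(** * The modulus of a convex combination of characters *)

Section WeightedCharacters.
Variables (R : realType) (rs : seq R) (w : R -> R) (theta : R).
Hypothesis rs_uniq : uniq rs.
Hypothesis w_ge0 : forall a, 0 <= w a.
Hypothesis w_sum : \sum_(a <- rs) w a = 1.
Hypothesis theta_rs : theta \in rs.

(** With w a = (E_a)_uu and [rs] a list resolving the identity, this is the entry U(t)_uu. *)
Definition char_sum (t : R) : R[i] :=
  \sum_(a <- rs) ((w a)%:C)%C * expi (t * a).

Local Notation amp t := (Normc.normc (char_sum t)).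
Local Notation bound := (2 * w theta - 1).

Lemma weighted_expi (s : seq R) (f : R -> R) :
  \sum_(a <- s) ((w a)%:C)%C * expi (f a) =
  ((\sum_(a <- s) w a * cos (f a)) +i* (\sum_(a <- s) w a * sin (f a)))%C.
Proof.
elim: s => [|a s IHs]; first by rewrite !big_nil.
by rewrite !big_cons IHs; apply: eq_ReIm => /=; ring.
Qed.

Lemma Re_le_normc (z : R[i]) : complex.Re z <= Normc.normc z.
Proof.
case: z => a b /=; apply: le_trans (ler_norm a) _.
by rewrite -sqrtr_sqr ler_sqrt ?lerDl ?sqr_ge0// addr_ge0 ?sqr_ge0.
Qed.

Lemma amp_shift t :
  amp t = Normc.normc (\sum_(a <- rs) ((w a)%:C)%C * expi (t * (a - theta))).
Proof.
rewrite -[RHS]mul1r -(normc_expi (t * theta)) -Normc.normcM mulr_sumr.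
congr Normc.normc; apply: eq_bigr => a _.
by rewrite mulrCA -expiD; congr (_ * expi _); ring.
Qed.

Lemma sum_w_neq : \sum_(a <- rs | a != theta) w a = 1 - w theta.
Proof.
by have := w_sum; rewrite (bigD1_seq theta)//= => <-; rewrite addrAC subrr add0r.
Qed.

(** Once the phase e^{it theta} is removed, the modulus is at least the real part w theta + sum w a
    cos (t (a - theta)). Total mass 1 rewrites this as [bound] plus the sum of the defects. *)
Lemma amp_defect t :
  \sum_(a <- rs | a != theta) w a * (1 + cos (t * (a - theta))) <= amp t - bound.
Proof.
rewrite amp_shift; set z := \sum_(a <- rs) _.
have := Re_le_normc z; rewrite {1}/z weighted_expi /= (bigD1_seq theta)//=.
rewrite subrr mulr0 cos0 mulr1.
under [X in _ -> X <= _]eq_bigr do rewrite mulrDr mulr1.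
by rewrite big_split /= sum_w_neq; lra.
Qed.

Lemma term_ge0 t a : 0 <= w a * (1 + cos (t * (a - theta))).
Proof. by rewrite mulr_ge0//; have := cos_geN1 (t * (a - theta)); lra. Qed.

Lemma bound_le_amp t : bound <= amp t.
Proof.
rewrite -subr_ge0; apply: le_trans (amp_defect t).
by apply: sumr_ge0 => a _; exact: term_ge0.
Qed.

Lemma amp_defect_term t a : a \in rs -> a != theta ->
  w a * (1 + cos (t * (a - theta))) <= amp t - bound.
Proof.
move=> ars ath; apply: le_trans (amp_defect t).
rewrite (big_rem a) //= ath lerDl; apply: sumr_ge0 => b _; exact: term_ge0.
Qed.

(** The square of |e^{ix} + 1| is 2 + 2 cos x. *)
Lemma normc_expiD1 (x e : R) : 0 <= e -> cos x <= -1 + e ^+ 2 / 2 ->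
  Normc.normc (expi x + 1) <= e.
Proof.
move=> e0 cx /=; rewrite -[leRHS](ger0_norm e0) -sqrtr_sqr ler_sqrt ?sqr_ge0//.
by have := cos2Dsin2 x; nra.
Qed.

Lemma normc_sum (s : seq R) (P : pred R) (F : R -> R[i]) :
  Normc.normc (\sum_(a <- s | P a) F a) <= \sum_(a <- s | P a) Normc.normc (F a).
Proof.
elim/big_rec2: _ => [|a y z _ yz]; first by rewrite Normc.normc0.
by apply: le_trans (le_normcD _ _) _; rewrite lerD2l.
Qed.

(** Replacing each e^{it(a - theta)} by -1 gives w theta - (1 - w theta) = [bound]. Each replacement
    costs at most e, with total weight 1 - w theta <= 1. *)
Lemma amp_le t e : 0 <= bound -> 0 <= e ->
  (forall a, a \in rs -> w a != 0 -> a != theta ->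
     cos (t * (a - theta)) <= -1 + e ^+ 2 / 2) ->
  amp t <= bound + e.
Proof.
move=> b0 e0 cosP; rewrite amp_shift (bigD1_seq theta)//=.
rewrite subrr mulr0 expi0 mulr1.
have -> : \sum_(a <- rs | a != theta) ((w a)%:C)%C * expi (t * (a - theta)) =
    \sum_(a <- rs | a != theta) ((w a)%:C)%C * (expi (t * (a - theta)) + 1)
    - ((1 - w theta)%:C)%C.
  rewrite -sum_w_neq rmorph_sum -sumrB.
  by apply: eq_bigr => a _; rewrite [_ * (expi _ + 1)]mulrDr mulr1 addrK.
rewrite addrCA -rmorphB /=.
have -> : w theta - (1 - w theta) = bound by ring.
apply: le_trans (le_normcD _ _) _; rewrite addrC normc_real ger0_norm// lerD2l.
apply: le_trans (normc_sum _ _ _) _.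
apply: (@le_trans _ _ (\sum_(a <- rs | a != theta) w a * e)); last first.
  rewrite -mulr_suml sum_w_neq ler_piMl//.
  by have := w_ge0 theta; lra.
rewrite big_seq_cond [leRHS]big_seq_cond; apply: ler_sum => a /andP[ars ath].
rewrite Normc.normcM normc_real ger0_norm//.
have [->|wa] := eqVneq (w a) 0; first by rewrite !mul0r.
by rewrite ler_wpM2l// normc_expiD1// cosP.
Qed.

Lemma amp_eq t : 0 <= bound ->
  amp t = bound <->
  (forall a, a \in rs -> w a != 0 -> a != theta -> cos (t * (a - theta)) = -1).
Proof.
move=> b0; split=> [ab a ars wa ath|cosP].
  have wp : 0 < w a by rewrite lt0r wa w_ge0.
  have := amp_defect_term t ars ath; rewrite ab subrr pmulr_rle0// => c1.
  by have c2 := cos_geN1 (t * (a - theta)); lra.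
apply/eqP; rewrite eq_le bound_le_amp andbT -[leRHS]addr0; apply: amp_le => //.
by move=> a ars wa ath; rewrite (cosP a ars wa ath) expr0n mul0r addr0.
Qed.

Lemma amp_le1 t : amp t <= 1.
Proof.
apply: le_trans (normc_sum _ _ _) _; rewrite -w_sum; apply: ler_sum => a _.
by rewrite Normc.normcM normc_real ger0_norm// normc_expi mulr1.
Qed.

(** A convex combination z of unit numbers has modulus 1 only if all those of nonzero weight equal
    z. Hence translating by tau multiplies the sum by z. *)
Lemma amp_periodic tau t : amp tau = 1 -> amp (t + tau) = amp t.
Proof.
move=> a1; pose z := char_sum tau.
have zE : z = ((\sum_(a <- rs) w a * cos (tau * a))
    +i* (\sum_(a <- rs) w a * sin (tau * a)))%C by rewrite /z/char_sum weighted_expi.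
set p := (\sum_(a <- rs) w a * cos (tau * a)) in zE.
set r := (\sum_(a <- rs) w a * sin (tau * a)) in zE.
have pr1 : p ^+ 2 + r ^+ 2 = 1.
  have : Normc.normc z = 1 by [].
  rewrite zE /= => /(congr1 (fun x => x ^+ 2)).
  by rewrite sqr_sqrtr ?addr_ge0 ?sqr_ge0// expr1n.
have csP a : p * cos (tau * a) + r * sin (tau * a) <= 1.
  have := sqr_ge0 (r - sin (tau * a)); have := sqr_ge0 (p - cos (tau * a)).
  by have := cos2Dsin2 (tau * a); move: pr1; nra.
have : \sum_(a <- rs) w a * (1 - (p * cos (tau * a) + r * sin (tau * a))) = 0.
  under eq_bigr do rewrite mulrBr mulr1 mulrDr mulrCA [w _ * (r * _)]mulrCA.
  by rewrite sumrB big_split /= w_sum -!mulr_sumr -/p -/r -!expr2 pr1 subrr.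
move/eqP; rewrite psumr_eq0; last by move=> a _; rewrite mulr_ge0// subr_ge0.
move=> /allP wP.
have zP a : a \in rs -> w a != 0 -> expi (tau * a) = z.
  move=> ars wa; have := wP a ars; rewrite mulf_eq0 (negPf wa) /= => /eqP cs1.
  have c2 := cos2Dsin2 (tau * a).
  have D0 : (p - cos (tau * a)) ^+ 2 + (r - sin (tau * a)) ^+ 2 = 0.
    by rewrite -[RHS](mulr0 2) -[in RHS]cs1; move: pr1 c2; nra.
  move/eqP: D0; rewrite paddr_eq0 ?sqr_ge0// !sqrf_eq0 !subr_eq0.
  by move=> /andP[/eqP p1 /eqP r1]; rewrite zE p1 r1.
have -> : char_sum (t + tau) = char_sum t * z.
  rewrite /char_sum mulr_suml !big_seq; apply: eq_bigr => a ars.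
  have [->|wa] := eqVneq (w a) 0; first by rewrite !mul0r.
  by rewrite mulrDl expiD (zP a ars wa) mulrA.
by rewrite Normc.normcM [X in _ * X]a1 mulr1.
Qed.

Lemma continuous_weighted (f : R -> R) : continuous f ->
  continuous (fun t : R => (\sum_(a <- rs) w a * f (t * a) : R)).
Proof.
move=> cf t; apply: cvg_big => [|a _]; first exact: add_continuous.
apply: cvgMr; apply: continuous_comp; last exact: cf.
by apply: cvgMl; exact: cvg_id.
Qed.

Lemma ampE t : amp t = Num.sqrt ((\sum_(a <- rs) w a * cos (t * a)) ^+ 2 +
                                 (\sum_(a <- rs) w a * sin (t * a)) ^+ 2).
Proof. by rewrite /char_sum weighted_expi. Qed.

Lemma amp_continuous : continuous (fun t : R => (amp t : R)).
Proof.
rewrite (funext ampE) => t.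
have cs := continuous_weighted (@continuous_cos R).
have sn := continuous_weighted (@continuous_sin R).
apply: (@continuous_comp _ _ _ (fun t : R => (\sum_(a <- rs) w a * cos (t * a)) ^+ 2 +
  (\sum_(a <- rs) w a * sin (t * a)) ^+ 2) (@Num.sqrt R)); last exact: sqrt_continuous.
by apply: cvgD; [exact: (continuousM (cs t) (cs t)) | exact: (continuousM (sn t) (sn t))].
Qed.

Lemma amp_min_attained tau : 0 < tau -> amp tau = 1 ->
  exists2 t0, 0 < t0 & forall t, 0 < t -> amp t0 <= amp t.
Proof.
(* The period [tau, 2 tau] is taken rather than [0, tau] so that the minimiser is positive. *)
move=> tau0 a1; have tau2 : tau <= 2 * tau by lra.
have [|c] := @EVT_min _ (fun t => amp t) _ _ tau2.
  by move=> t; apply: continuous_subspaceT; exact: amp_continuous.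
rewrite in_itv /= => /andP[tc ct] cmin; exists c; first exact: lt_le_trans tc.
move=> t t0; pose j := Num.truncn (t / tau); pose r := t - tau *+ j.
have per k x : amp (x + tau *+ k) = amp x.
  elim: k => [|k IHk]; first by rewrite addr0.
  by rewrite mulrSr addrA amp_periodic.
have tr : 0 <= r < tau.
  have /andP[j1 j2] := truncn_itv (ltW (divr_gt0 t0 tau0)).
  rewrite ler_pdivlMr// in j1; rewrite ltr_pdivrMr// -natr1 mulrDl mul1r in j2.
  by rewrite /r -[tau *+ j]mulr_natl subr_ge0 ltrBlDr j1 addrC.
have -> : amp t = amp (r + tau *+ 1).
  by rewrite per -(per j r) /r subrK.
apply: cmin; rewrite in_itv /= mulr1n; lra.
Qed.

End WeightedCharacters.

(** * Odd multiples of pi, 2-adic valuations and quadratic integers *)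

Section OddMultiples.
Variable R : realType.

Lemma cos_periodz (x : R) (j : int) : cos (x + (pi *+ 2) *~ j) = cos x.
Proof.
have per (y : R) k : cos (y + (pi *+ 2) *+ k) = cos y.
  exact: (periodicn (@cosD2pi R)).
by case: j => k; rewrite ?NegzE ?mulrNz -!pmulrn// -[LHS](per _ k.+1) subrK.
Qed.

Lemma cos_eq1_itv (y : R) : 0 <= y < pi *+ 2 -> cos y = 1 -> y = 0.
Proof.
move=> /andP[y0 y2] cy; have pi0 := @pi_gt0 R.
have [ypi|piy] := leP y pi.
  by apply: cos_inj; rewrite ?in_itv /= ?y0 ?ypi ?lexx ?pi_ge0// cos0.
have : pi *+ 2 - y = 0.
  apply: cos_inj; rewrite ?in_itv /= ?lexx ?pi_ge0//.
    by apply/andP; split; lra.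
  by rewrite cos0 addrC cosD2pi cosN.
lra.
Qed.

Lemma cos_eqN1 (x : R) : cos x = -1 -> exists k : int, x = (2 * k + 1)%:~R * pi.
Proof.
move=> cx; have pi0 := @pi_gt0 R; have p2 : 0 < pi *+ 2 :> R by lra.
pose k := Num.floor ((x - pi) / (pi *+ 2)); exists k.
have kE : (pi *+ 2) *~ k = k%:~R * (pi *+ 2) :> R by rewrite mulrzl.
have y0 : x - pi - (pi *+ 2) *~ k = 0.
  apply: cos_eq1_itv; last first.
    by rewrite -mulrNz cos_periodz; have := cosDpi (x - pi); rewrite subrK cx; lra.
  have /andP[k1 k2] := floor_itv ((x - pi) / (pi *+ 2)).
  rewrite ler_pdivlMr// in k1; rewrite ltr_pdivrMr// intrD mulr1z mulrDl mul1r in k2.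
  by rewrite kE subr_ge0 k1 ltrBlDl.
by move: y0; rewrite kE rmorphD rmorphM /=; lra.
Qed.

Lemma cos_odd_mul_pi (k : int) : odd `|k|%N -> cos (k%:~R * pi) = -1 :> R.
Proof.
move=> ok; have [j ->] : exists j : int, k = 2 * j + 1.
  by exists ((k - 1) %/ 2)%Z; lia.
have -> : (2 * j + 1)%:~R * pi = pi + (pi *+ 2) *~ j :> R.
  by rewrite -mulrzl rmorphD rmorphM /=; ring.
by rewrite cos_periodz cospi.
Qed.

(** All t (x - theta) are odd multiples of pi. Comparing two of them gives c (2 k0 + 1) = c0 (2 k +
    1), so c and c0 have the same 2-adic valuation. *)
Lemma equal_val2_of_odd (S : set R) (theta t : R) (D : nat) :
  (0 < D)%N -> 0 < t ->
  (forall x, S x -> x != theta -> cos (t * (x - theta)) = -1) ->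
  (forall x, S x -> exists c : int, (x - theta) / Num.sqrt D%:R = c%:~R) ->
  equal_val2 S theta D.
Proof.
move=> D0 t0 cosS intS.
have [[x0 [Sx0 x0th]]|NS] := pselect (exists x, S x /\ x != theta); last first.
  (* Without an element other than theta the condition is vacuous, and 0 serves as the common
     valuation. *)
  by exists 0%N => x Sx xth; case: NS; exists x.
have sD : 0 < Num.sqrt D%:R :> R by rewrite sqrtr_gt0 ltr0n.
have [c0 c0E] := intS _ Sx0; exists (logn 2 `|c0|%N) => x Sx xth.
have [c cE] := intS _ Sx; exists c => //.
have [k0 k0E] := cos_eqN1 (cosS _ Sx0 x0th).
have [k kE] := cos_eqN1 (cosS _ Sx xth).
have xE : x - theta = c%:~R * Num.sqrt D%:R by rewrite -cE divfK ?gt_eqF.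
have x0E : x0 - theta = c0%:~R * Num.sqrt D%:R by rewrite -c0E divfK ?gt_eqF.
have cn0 : c != 0.
  by apply: contraNneq xth => c00; rewrite -subr_eq0 xE c00 mul0r.
have c0n0 : c0 != 0.
  by apply: contraNneq x0th => c00; rewrite -subr_eq0 x0E c00 mul0r.
have E : c * (2 * k0 + 1) = c0 * (2 * k + 1).
  have tD : t * Num.sqrt D%:R * pi != 0 :> R.
    by rewrite !mulf_neq0 ?gt_eqF// pi_gt0.
  apply: (@intr_inj R); rewrite !rmorphM /=; apply: (mulfI tD).
  rewrite xE in kE; rewrite x0E in k0E.
  have -> : t * Num.sqrt D%:R * pi * (c%:~R * (2 * k0 + 1)%:~R) =
     (t * (c%:~R * Num.sqrt D%:R)) * ((2 * k0 + 1)%:~R * pi) by ring.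
  by rewrite kE -k0E; ring.
have := congr1 (fun z : int => logn 2 `|z|%N) E.
have log_odd (j : int) : logn 2 (absz (2 * j + 1)) = 0%N.
  by rewrite logn_coprime// coprime2n; lia.
by rewrite /= !abszM !lognM ?absz_gt0//; rewrite ?log_odd ?addn0//; lia.
Qed.

Lemma square_free_gt0 D : square_free D -> (0 < D)%N.
Proof. by case: D => // /(_ 2%N isT); rewrite dvdn0. Qed.

(** If q is nonzero in p^2 = q^2 D, a prime divisor of the square-free D has even exponent on the
    left and odd exponent on the right. *)
Lemma sqrt_square_free_irrational (D : nat) (p q : int) :
  (1 < D)%N -> square_free D ->
  p%:~R + q%:~R * Num.sqrt D%:R = 0 :> R -> p = 0 /\ q = 0.
Proof.
move=> D1 sfD pq.
have E : p ^+ 2 = q ^+ 2 * D%:Z.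
  have s2 : Num.sqrt D%:R ^+ 2 = D%:~R :> R by rewrite sqr_sqrtr ?ler0n.
  apply: (@intr_inj R); rewrite !expr2 !intrM -s2.
  have -> : p%:~R = - (q%:~R * Num.sqrt D%:R) :> R by apply/eqP; rewrite -addr_eq0 pq.
  by ring.
have [q0|q0] := eqVneq q 0.
  by split=> //; apply/eqP; rewrite -sqrf_eq0 E q0 expr0n mul0r.
have p0 : p != 0.
  by rewrite -sqrf_eq0 E mulf_neq0 ?sqrf_eq0//; lia.
have rP := pdiv_prime D1; set r := pdiv D in rP.
have := congr1 (fun z : int => logn r `|z|%N) E.
rewrite /= abszM !abszX /= lognM ?expn_gt0 ?absz_gt0 ?q0//; last by lia.
rewrite !lognX; have := sfD _ rP; rewrite (pfactor_dvdn 2 rP) ?(ltnW D1)//.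
have : (0 < logn r D)%N by rewrite logn_gt0 mem_primes rP (ltnW D1) pdiv_dvd.
lia.
Qed.

(** Separating the rational and irrational parts of the quadratic equation gives, for b nonzero, a^2
    - b^2 D = 4 gamma. Since 4 does not divide D, a and b have the same parity; for b = 0 the
    equation itself makes a even. *)
Lemma quadratic_integer_parity (D : nat) (a b : int) :
  (1 < D)%N -> square_free D ->
  quadratic_integer (2^-1 * (a%:~R + b%:~R * Num.sqrt D%:R) : R) ->
  (2 %| b - a)%Z.
Proof.
move=> D1 sfD [beta [gamma]]; set s : R := Num.sqrt D%:R => E.
have s2 : s ^+ 2 = D%:R by rewrite sqr_sqrtr ?ler0n.
have /sqrt_square_free_irrational[]// :
    (a ^+ 2 + b ^+ 2 * D%:Z + 2 * beta * a + 4 * gamma)%:~R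
    + (2 * a * b + 2 * beta * b)%:~R * s = 0.
  rewrite !(rmorphD, rmorphM, rmorphXn) /= -pmulrn -s2 -[RHS](mulr0 4) -[in RHS]E.
  by field.
rewrite !expr2 => E1 E2; have := sfD 2%N isT => D4.
have [b0|b0] := eqVneq b 0.
  have [a2|a2] := boolP (2 %| a)%Z; first by rewrite b0; lia.
  have [a' aE] : exists a', a = 2 * a' + 1 by exists (a %/ 2)%Z; lia.
  move: E1; rewrite b0 aE !mul0r addr0 => E1.
  have : 1 = 2 * (- 2 * a' * a' - 2 * a' - 2 * beta * a' - beta - 2 * gamma) by lia.
  lia.
have {E2} bE : beta = - a.
  apply/eqP; rewrite -addr_eq0; apply/eqP/(mulIf b0); rewrite mul0r mulrDl; lia.
have {}E1 : a * a - b * b * D%:Z = 4 * gamma by rewrite bE in E1; lia.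
rewrite -[(2 ^ 2)%N]/4%N in D4.
have [[a' aE]|[a' aE]] : (exists a', a = 2 * a') \/ (exists a', a = 2 * a' + 1).
  by have [a2|a2] := boolP (2 %| a)%Z; [left|right]; exists (a %/ 2)%Z; lia.
- have [[b' bE']|[b' bE']] : (exists b', b = 2 * b') \/ (exists b', b = 2 * b' + 1).
    by have [a2|a2] := boolP (2 %| b)%Z; [left|right]; exists (b %/ 2)%Z; lia.
    lia.
  exfalso; apply: (negP D4); rewrite aE bE' in E1.
  have : D%:Z = 4 * (a' * a' - gamma - (b' * b' + b') * D%:Z) by lia.
  lia.
have [[b' bE']|[b' bE']] : (exists b', b = 2 * b') \/ (exists b', b = 2 * b' + 1).
    by have [a2|a2] := boolP (2 %| b)%Z; [left|right]; exists (b %/ 2)%Z; lia.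
  rewrite aE bE' in E1.
  have : 1 = 2 * (2 * gamma + 2 * b' * b' * D%:Z - 2 * a' * a' - 2 * a') by lia.
  lia.
lia.
Qed.

(** In the quadratic case both irrational coefficients have the parity of the common a, so half
    their difference is an integer. *)
Lemma integral_form_diff (S : set R) (theta : R) (D : nat) :
  integral_form S D -> S theta ->
  (0 < D)%N /\ forall x, S x -> exists c : int, (x - theta) / Num.sqrt D%:R = c%:~R.
Proof.
move=> [[-> Sint] Sth|[D1 sfD [a Sq]] Sth].
  split=> // x Sx; rewrite sqrtr1 divr1; apply/intrP.
  by rewrite rpredB// Sint.
split=> [|x Sx]; first exact: ltnW.
have [qx [b xE]] := Sq _ Sx; have [qt [b' tE]] := Sq _ Sth.
rewrite xE in qx; rewrite tE in qt.
have /dvdzP[c cE] := quadratic_integer_parity D1 sfD qx.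
have /dvdzP[c' cE'] := quadratic_integer_parity D1 sfD qt.
exists (c - c').
have sD : Num.sqrt D%:R != 0 :> R by rewrite gt_eqF// sqrtr_gt0 ltr0n ltnW.
rewrite xE tE; have -> : b = a + 2 * c by lia.
have -> : b' = a + 2 * c' by lia.
by rewrite !(rmorphD, rmorphM, rmorphN) /=; field.
Qed.

End OddMultiples.

(** * Conjugation-closed sets of algebraic integers in an arithmetic progression *)

Section ConjugateClosed.
Variable R : realType.
Local Notation pQtoR := (map_poly (@ratr R)).
Local Notation pZtoR := (map_poly (intr : int -> R)).
Local Notation pZtoQ := (map_poly (intr : int -> rat)).

Lemma pQtoR_intr (p : {poly int}) : pQtoR (pZtoQ p) = pZtoR p.
Proof.
by rewrite -map_poly_comp; apply: eq_map_poly => z /=; rewrite ratr_int.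
Qed.

Lemma minpoly_exists (x : R) (P : {poly rat}) : P != 0 -> root (pQtoR P) x ->
  exists2 p : {poly rat}, p \is monic /\ root (pQtoR p) x &
    forall g : {poly rat}, root (pQtoR g) x -> p %| g.
Proof.
move=> P0 Px.
have exN : exists k, `[< exists2 p : {poly rat}, p != 0 & root (pQtoR p) x /\ size p = k >].
  by exists (size P); apply/asboolP; exists P.
case: (ex_minnP exN) => k /asboolP[p p0 [px sp]] kmin.
exists ((lead_coef p)^-1 *: p).
  split; first by rewrite monicE lead_coefZ mulVf ?lead_coef_eq0.
  by rewrite map_polyZ rootZ// fmorph_eq0 invr_eq0 lead_coef_eq0.
move=> g gx; rewrite dvdpZl ?invr_eq0 ?lead_coef_eq0// /dvdp.
apply/negPn/negP => r0.
have := kmin (size (g %% p)); rewrite leqNgt -sp ltn_modp p0 => H.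
suff: false by []; apply: H; apply/asboolP; exists (g %% p) => //; split=> //.
move: gx; rewrite {1}(divp_eq g p) rmorphD rmorphM /= /root hornerD hornerM.
by rewrite (rootP px) mulr0 add0r.
Qed.

(** Gauss's lemma: p is a rational multiple of an integer polynomial dividing P over the integers.
    The leading coefficient of that divisor is 1 or -1, hence so is the scalar. *)
Lemma monic_dvd_int (p : {poly rat}) (P : {poly int}) :
  p \is monic -> P \is monic -> p %| pZtoQ P -> forall i, p`_i \is a Num.int.
Proof.
move=> pmon Pmon /dvdpP_rat_int[p1 [a a0 pE] [r PE]] i.
have := monicP Pmon; rewrite PE lead_coefM => lr.
have l1 : `|lead_coef p1|%N = 1%N.
  by have := congr1 absz lr; rewrite abszM /= => /eqP; rewrite muln_eq1 => /andP[/eqP].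
have := monicP pmon; rewrite pE lead_coefZ lead_coef_map_inj//; last exact: intr_inj.
have al : a * (lead_coef p1)%:~R = 1 -> a \is a Num.int.
  have [->|->] : lead_coef p1 = 1 \/ lead_coef p1 = -1 by lia.
    by rewrite mulr1 => ->; rewrite rpred1.
  by rewrite rmorphN1 mulrN1 => /eqP; rewrite eqr_oppLR => /eqP ->; rewrite rpredN rpred1.
by move=> /al aint; rewrite coefZ coef_map rpredM// intr_int.
Qed.

(** Newton's identity 2 e_2 = p_1^2 - p_2. The factor [(1 < size s)] voids the lengths at which the
    index [(size s).-2] is truncated. *)
Lemma coef2_prod_XsubC (s : seq R) :
  ((\prod_(z <- s) ('X - z%:P))`_(size s).-2 *+ (1 < size s) *+ 2 =
   ((\sum_(z <- s) z) ^+ 2 - \sum_(z <- s) z ^+ 2) *+ (1 < size s))%R.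
Proof.
case: s => [|x [|y s]]; rewrite ?mulr0n ?mul0rn//=.
elim: s x y => [|z s IHs] x y.
  rewrite !big_cons !big_nil !mulr1 mulrBl coefB coefXM /= coefCM.
  by rewrite coefB coefX coefC /= !mulr1n addr0; ring.
rewrite big_cons mulrBl coefB coefXM /= coefCM.
have := IHs y z; have := @coefPn_prod_XsubC R [:: y, z & s] isT.
rewrite /= => -> H; rewrite !mulr1n in H *.
rewrite mulrnBl H !big_cons; ring.
Qed.

Lemma square_free_part N : (0 < N)%N ->
  exists g D, [/\ N = (g ^ 2 * D)%N, (0 < g)%N & square_free D].
Proof.
have [m] := ubnP N; elim: m N => // m IHm N Nm N0.
have [[p pp pN]|Nsf] := pselect (exists2 p, prime p & (p ^ 2 %| N)%N); last first.
  exists 1%N, N; split=> //; first by rewrite mul1n.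
  by move=> p pp; apply/negP => pN; apply: Nsf; exists p.
have p1 := prime_gt1 pp; have /dvdnP[q qE] := pN.
have q0 : (0 < q)%N by case: q qE N0 => // ->.
have [||g [D [qD g0 sfD]]] := IHm q => //.
  by move: Nm; rewrite qE; nia.
exists (p * g)%N, D; split=> //; last by rewrite muln_gt0 g0 prime_gt0.
by rewrite qE qD expnMn; ring.
Qed.

(** A prime dividing the denominator of r is coprime to the numerator, so its square would divide
    D. *)
Lemma rat_square_free_int (r : rat) (D : nat) :
  square_free D -> r ^+ 2 * D%:R \is a Num.int -> r \is a Num.int.
Proof.
move=> sfD /intrP[m rD].
have d0 : (denq r)%:~R != 0 :> rat by rewrite intr_eq0.
have E : numq r ^+ 2 * D%:Z = m * denq r ^+ 2.
  apply: (@intr_inj rat); rewrite !expr2 !intrM -rD -[r in r ^+ 2]divq_num_den.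
  by rewrite expr2 -[D%:~R]/(D%:R); field.
suff dr : `|denq r|%N = 1%N.
  by rewrite -[r]divq_num_den -absz_denq dr divr1 intr_int.
apply/eqP; rewrite eqn_leq absz_gt0 denq_eq0 andbT leqNgt; apply/negP => d1.
have pP := pdiv_prime d1; set p := pdiv _ in pP.
have pd : (p %| `|denq r|)%N := pdiv_dvd _.
apply: (negP (sfD _ pP)).
have cop : coprime (p ^ 2) (`|numq r| ^ 2).
  rewrite coprimeXl// coprimeXr// coprime_sym.
  exact: coprime_dvdr pd (coprime_num_den r).
rewrite -(Gauss_dvdr _ cop).
have -> : (`|numq r| ^ 2 * D = `|m| * `|denq r| ^ 2)%N.
  by rewrite -!mulnn; have := congr1 absz E; rewrite !expr2 !abszM.
by rewrite dvdn_mull// dvdn_exp2r.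
Qed.

Lemma square_free_sqrt_irrational (D : nat) (r : rat) : (1 < D)%N -> square_free D ->
  r != 0 -> forall m, ratr r * Num.sqrt D%:R != ratr m :> R.
Proof.
move=> D1 sfD r0 m; apply/negP => /eqP E.
have d0 : (denq r)%:~R != 0 :> R by rewrite intr_eq0.
have d0' : (denq m)%:~R != 0 :> R by rewrite intr_eq0.
have ratrE (q : rat) : ratr q = (numq q)%:~R / (denq q)%:~R :> R by [].
have [] := @sqrt_square_free_irrational R D (- numq m * denq r) (numq r * denq m) D1 sfD.
  move: E; rewrite !ratrE => /(congr1 (fun z => z * (denq r)%:~R * (denq m)%:~R)).
  rewrite !intrM mulrNz => E.
  have -> : (numq r)%:~R * (denq m)%:~R * Num.sqrt D%:R =
    (numq r)%:~R / (denq r)%:~R * Num.sqrt D%:R * (denq r)%:~R * (denq m)%:~R :> R by field.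
  by rewrite E; field.
by move=> _ /eqP; rewrite mulf_eq0 numq_eq0 denq_eq0 (negPf r0).
Qed.

Variables (S : set R) (theta delta : R) (PZ : {poly int}) (zs : seq R).
Hypothesis S_conj : conj_closed S.
Hypothesis S_theta : S theta.
Hypothesis PZ_monic : PZ \is monic.
Hypothesis PZ_split : pZtoR PZ = \prod_(z <- zs) ('X - z%:P).
Hypothesis S_root : forall x, S x -> root (pZtoR PZ) x.
Hypothesis S_progression :
  forall x, S x -> exists k : int, x = theta + k%:~R * delta.

Lemma algebraic_integer_minpoly x : S x ->
  exists2 p : {poly rat}, [/\ p \is monic, root (pQtoR p) x &
      forall i, p`_i \is a Num.int] &
    forall g : {poly rat}, root (pQtoR g) x -> p %| g.
Proof.
move=> Sx; have PQ0 : pZtoQ PZ != 0 by apply/monic_neq0/monic_map.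
have PQx : root (pQtoR (pZtoQ PZ)) x by rewrite pQtoR_intr S_root.
have [p [pmon px] pmin] := minpoly_exists PQ0 PQx; exists p => //.
by split=> //; apply: monic_dvd_int pmon PZ_monic _; exact: pmin.
Qed.

Lemma rational_int (r : rat) : S (ratr r) -> r \is a Num.int.
Proof.
move=> /algebraic_integer_minpoly[p [pmon px pint] /(_ ('X - r%:P))].
rewrite rmorphB /= map_polyX map_polyC /= root_XsubC eqxx => /(_ isT) pX.
suff pE : p = 'X - r%:P.
  by have := pint 0%N; rewrite pE coefB coefX coefC /= sub0r rpredN.
apply/eqP; rewrite -eqp_monic ?monicXsubC// /eqp pX /=.
by rewrite dvdp_XsubCl -(fmorph_root (@ratr R)).
Qed.

(** The irrational x is a root of X^2 - 2 m X + (m^2 - s^2 D), which is therefore its minimal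
    polynomial and has integer coefficients. *)
Lemma quadratic_coefs (x : R) (m s : rat) (D : nat) :
  (1 < D)%N -> square_free D -> s != 0 -> S x -> x = ratr m + ratr s * Num.sqrt D%:R ->
  (2 * m \is a Num.int) && (m ^+ 2 - s ^+ 2 * D%:R \is a Num.int).
Proof.
move=> D1 sfD s0 Sx xE.
have [p [pmon px pint] pmin] := algebraic_integer_minpoly Sx.
pose f : {poly rat} := 'X ^+ 2 - (2 * m) *: 'X + (m ^+ 2 - s ^+ 2 * D%:R)%:P.
have fx : root (pQtoR f) x.
  rewrite /f !(rmorphD, rmorphB, rmorphN) /=.
  rewrite !(map_polyZ, map_polyXn, map_polyX, map_polyC) /=.
  rewrite /root !hornerE !(rmorphB, rmorphM, rmorphXn) /= !ratr_nat xE.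
  have := @sqr_sqrtr R D%:R (ler0n _ _); set c := Num.sqrt _ => c2.
  by apply/eqP; rewrite -c2; ring.
have fsz : size f = 3%N.
  rewrite /f -addrA size_polyDl size_polyXn//.
  apply: leq_ltn_trans (size_polyD _ _) _; rewrite gtn_max size_polyN.
  rewrite (leq_ltn_trans (size_scale_leq _ _)) ?size_polyX//=.
  by rewrite (leq_ltn_trans (size_polyC_leq1 _)).
have fmon : f \is monic.
  rewrite monicE lead_coefE fsz /f !coefD coefN coefZ coefXn coefX coefC /=.
  by rewrite mulr0 subr0 addr0.
have psz : (2 < size p)%N.
  rewrite ltnNge; apply/negP => p2.
  have sp1 : size p = 2%N.
    apply/eqP; rewrite eqn_leq p2 -(size_map_poly (@ratr R)).
    by apply: root_size_gt1 px; rewrite map_poly_eq0 monic_neq0.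
  have pE : p = 'X + (p`_0)%:P.
    apply/polyP => i; rewrite coefD coefX coefC.
    case: i => [|[|i]]; rewrite /= ?add0r ?addr0//.
      by have := monicP pmon; rewrite lead_coefE sp1.
    by rewrite nth_default// sp1.
  move: px; rewrite pE rmorphD /= map_polyX map_polyC /= /root !hornerE xE => /eqP E.
  have /eqP[] := square_free_sqrt_irrational D1 sfD s0 (- m - p`_0).
  by rewrite rmorphB rmorphN /=; lra.
have pf : p = f.
  apply/eqP; rewrite -eqp_monic// -(dvdp_size_eqp (pmin _ fx)).
  by rewrite eqn_leq dvdp_leq ?monic_neq0 ?pmin//= fsz.
have f0 : f`_0 = m ^+ 2 - s ^+ 2 * D%:R.
  by rewrite /f !(coefD, coefN, coefZ, coefXn, coefX, coefC) /=; ring.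
have f1 : f`_1 = - (2 * m).
  by rewrite /f !(coefD, coefN, coefZ, coefXn, coefX, coefC) /=; ring.
by have := pint 0%N; have := pint 1%N; rewrite pf f0 f1 rpredN => -> ->.
Qed.

(** The list holds the roots of the minimal polynomial of x: all real because it divides the split
    [PZ], all in S by closure under conjugation, with rational symmetric functions. *)
Lemma power_sums_rational (x : R) : S x -> ~ (exists r, x = ratr r) ->
  exists s : seq R, exists A B : rat,
    [/\ x \in s, (forall z, z \in s -> S z),
        \sum_(z <- s) z = ratr A & \sum_(z <- s) z ^+ 2 = ratr B].
Proof.
move=> Sx xirr; have [p [pmon px pint] pmin] := algebraic_integer_minpoly Sx.
have pP : pQtoR p %| \prod_(z <- zs) ('X - z%:P).
  by rewrite -PZ_split -pQtoR_intr dvdp_map pmin// pQtoR_intr S_root.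
have [msk pE] := dvdp_prod_XsubC pP; set s := mask msk zs in pE.
have {}pE : pQtoR p = \prod_(z <- s) ('X - z%:P).
  by apply/eqP; rewrite -eqp_monic ?monic_map// monic_prod_XsubC.
have xs : x \in s by rewrite -root_prod_XsubC -pE.
have s1 : (1 < size s)%N.
  rewrite ltnNge; apply/negP => s1; apply: xirr.
  case: s s1 xs pE => [|y [|]]//= _; rewrite inE => /eqP <-.
  rewrite big_seq1 => /(congr1 (fun f : {poly R} => f`_0)).
  rewrite coef_map coefB coefX coefC /= sub0r => E.
  by exists (- p`_0); rewrite rmorphN /= E opprK.
have sumE : \sum_(z <- s) z = ratr (- p`_(size s).-1).
  rewrite rmorphN /= -coef_map pE coefPn_prod_XsubC ?opprK//.
  by case: (s) s1.
exists s, (- p`_(size s).-1), ((- p`_(size s).-1) ^+ 2 - p`_(size s).-2 *+ 2).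
split=> //.
  move=> z zs'; apply: (S_conj Sx) => g gx.
  have := pmin _ gx; rewrite -(dvdp_map (@ratr R)) pE => /dvdpP[h ->].
  by rewrite rootM root_prod_XsubC zs' orbT.
rewrite rmorphB rmorphMn rmorphXn /= -sumE -coef_map pE.
by have := coef2_prod_XsubC s; rewrite s1 !mulr1n => ->; ring.
Qed.

(** The conjugates z = theta + k_z delta have a rational mean mu, so z - mu = (k_z - k0) delta with
    k0 the mean of the k_z. Summing squares gives Q delta^2 rational, where Q > 0 because the
    irrational x differs from mu. *)
Lemma delta_quadratic (x : R) : S x -> ~ (exists r, x = ratr r) ->
  exists rho mu k0 : rat, [/\ 0 < rho, delta ^+ 2 = ratr rho &
     theta = ratr mu - ratr k0 * delta].
Proof.
move=> Sx xirr; have [s [A [B [xs sS sA sB]]]] := power_sums_rational Sx xirr.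
have s0 : (size s)%:R != 0 :> rat by rewrite pnatr_eq0; case: (s) xs.
have s0R : (size s)%:R != 0 :> R by rewrite pnatr_eq0; case: (s) xs.
have [kk kkP] : exists kk : R -> int, forall z, z \in s -> z = theta + (kk z)%:~R * delta.
  have /choice[kk kkP] : forall z, exists k : int, z \in s -> z = theta + k%:~R * delta.
    move=> z; have [/sS/S_progression[k ->]|] := boolP (z \in s); first by exists k.
    by exists 0.
  by exists kk.
pose K : int := \sum_(z <- s) kk z.
pose mu := A / (size s)%:R; pose k0 := K%:~R / (size s)%:R : rat.
have thE : theta = ratr mu - ratr k0 * delta.
  rewrite /mu /k0 !rmorphM !fmorphV /= ratr_int ratr_nat -sA.
  have -> : \sum_(z <- s) z = (size s)%:R * theta + K%:~R * delta.
    rewrite [LHS]big_seq (eq_bigr (fun z => theta + (kk z)%:~R * delta)) => [|z]; last first.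
      by move=> zs'; exact: kkP.
    rewrite -big_seq big_split /= -mulr_suml /K rmorph_sum /=; congr (_ + _).
    by rewrite big_const_seq count_predT iter_addr_0 mulr_natl.
  by field.
pose q z : rat := (kk z)%:~R - k0.
have qE z : z \in s -> z - ratr mu = ratr (q z) * delta.
  by move=> zs'; rewrite {1}(kkP z zs') {1}thE /q rmorphB /= ratr_int; ring.
pose Q := \sum_(z <- s) q z ^+ 2.
have Q0 : 0 < Q.
  rewrite lt0r sumr_ge0 ?andbT; last by move=> z _; rewrite sqr_ge0.
  rewrite psumr_eq0; last by move=> z _; rewrite sqr_ge0.
  apply/negP => /allP/(_ x xs); rewrite sqrf_eq0 => /eqP qx.
  by apply: xirr; exists mu; apply/eqP; rewrite -subr_eq0 qE// qx rmorph0 mul0r.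
pose C := B - 2 * mu * A + (size s)%:R * mu ^+ 2.
have CE : ratr C = ratr Q * delta ^+ 2.
  have -> : ratr Q * delta ^+ 2 = \sum_(z <- s) (z - ratr mu) ^+ 2.
    rewrite rmorph_sum /= mulr_suml [LHS]big_seq [RHS]big_seq; apply: eq_bigr => z zs'.
    by rewrite qE// exprMn rmorphXn.
  have -> : ratr C = ratr B - 2 * ratr mu * ratr A + (size s)%:R * ratr mu ^+ 2 :> R.
    by rewrite /C !(rmorphD, rmorphN, rmorphM) /= !ratr_nat; ring.
  rewrite -sA -sB.
  rewrite [RHS](eq_bigr (fun z => z ^+ 2 - 2 * ratr mu * z + ratr mu ^+ 2)); last first.
    by move=> z _; ring.
  rewrite !big_split /= sumrN -mulr_sumr; congr (_ + _).
  by rewrite big_const_seq count_predT iter_addr_0 mulr_natl.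
have d2 : delta ^+ 2 = ratr (C / Q).
  by rewrite rmorphM fmorphV /= CE mulrAC divff ?mul1r// fmorph_eq0 gt_eqF.
exists (C / Q), mu, k0; split=> //.
rewrite -(ltr0q R) -d2 lt0r sqr_ge0 andbT sqrf_eq0; apply/negP => /eqP dl0.
by apply: xirr; exists mu; rewrite (kkP _ xs) thE dl0 !mulr0 subr0 addr0.
Qed.

(** If some element is irrational, delta is a rational multiple of sqrt D, so all of S has the form
    mu + s sqrt D with a common rational mu. Integrality of trace and norm then makes 2 mu and every
    2 s integers. *)
Lemma conj_closed_integral_form : exists D, integral_form S D.
Proof.
have [allrat|] := pselect (forall x, S x -> exists r, x = ratr r).
  exists 1%N; left; split=> // x Sx; have [r xE] := allrat _ Sx.
  rewrite xE in Sx *; have /intrP[z ->] := rational_int Sx.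
  by rewrite ratr_int intr_int.
move=> /existsNP[x /not_implyP[Sx xirr]].
have [rho [mu [k0 [rho0 d2 thE]]]] := delta_quadratic Sx xirr.
have dn0 : (0 < absz (numq rho * denq rho)%R)%N.
  by rewrite absz_gt0 mulf_neq0 ?denq_eq0// numq_eq0 gt_eqF.
have [g [D [gD g0 sfD]]] := square_free_part dn0.
pose c := Num.sqrt D%:R : R.
have c2 : c ^+ 2 = D%:R by rewrite sqr_sqrtr.
have [e [ee eE]] : exists e : rat, e != 0 /\ delta = ratr e * c.
  (* Multiplying numerator and denominator of rho by its denominator gives rho = g^2 D / (denq
     rho)^2; the sign of delta is settled afterwards. *)
  pose e0 : rat := g%:R / (denq rho)%:~R.
  have e00 : e0 != 0 by rewrite mulf_neq0 ?invr_eq0 ?intr_eq0 ?denq_eq0// pnatr_eq0 -lt0n.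
  have : delta ^+ 2 = (ratr e0 * c) ^+ 2.
    rewrite d2 exprMn c2 -ratr_nat -rmorphXn -rmorphM; congr ratr.
    have dq : (denq rho)%:~R != 0 :> rat by rewrite intr_eq0.
    have nd : (numq rho * denq rho)%:~R = g%:R ^+ 2 * D%:R :> rat.
      rewrite -natrX -natrM -gD -[RHS]/((_)%:Z%:~R) abszE ger0_norm//.
      by rewrite mulr_ge0 ?numq_ge0 ?denq_ge0// ltW.
    rewrite -[LHS]divq_num_den /e0 exprMn mulrAC -nd intrM; field.
    exact: dq.
  move/eqP; rewrite eqf_sqr => /orP[] /eqP ->; first by exists e0.
  by exists (- e0); rewrite oppr_eq0 rmorphN mulNr.
have form y : S y -> exists s : rat, y = ratr mu + ratr s * c.
  move=> /S_progression[k ->]; exists ((k%:~R - k0) * e).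
  by rewrite thE eE !(rmorphM, rmorphB) /= ratr_int; ring.
have D1 : (1 < D)%N.
  rewrite ltn_neqAle square_free_gt0// andbT; apply/negP => /eqP D1.
  apply: xirr; have [s ->] := form _ Sx; exists (mu + s).
  by rewrite /c -D1 sqrtr1 mulr1 rmorphD.
have [sx xE] := form _ Sx.
have sx0 : sx != 0.
  by apply/negP => /eqP s0; apply: xirr; exists mu; rewrite xE s0 rmorph0 mul0r addr0.
have /andP[/intrP[a aE] _] := quadratic_coefs D1 sfD sx0 Sx xE.
have mua : ratr mu = 2^-1 * a%:~R :> R.
  by rewrite -ratr_int -aE rmorphM /= ratr_nat mulKf.
exists D; right; split=> //; exists a => y Sy; have [s yE] := form _ Sy.
(* A rational element of S equals mu, and takes b = 0. *)
have [s0|s0] := eqVneq s 0.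
  have yr : y = ratr mu by rewrite yE s0 rmorph0 mul0r addr0.
  rewrite yr in Sy; have /intrP[z zE] := rational_int Sy.
  split; last by exists 0; rewrite mul0r addr0 yr.
  by exists (- z), 0; rewrite yr zE ratr_int mulrNz; ring.
have /andP[_ /intrP[h hE]] := quadratic_coefs D1 sfD s0 Sy yE.
have /intrP[b bE] : 2 * s \is a Num.int.
  apply: (rat_square_free_int sfD).
  have -> : (2 * s) ^+ 2 * D%:R = (2 * mu) ^+ 2 - 4 * (mu ^+ 2 - s ^+ 2 * D%:R) by ring.
  by rewrite aE hE rpredB ?rpredX ?rpredM ?intr_int ?intr_nat.
have sb : ratr s = 2^-1 * b%:~R :> R.
  by rewrite -ratr_int -bE rmorphM /= ratr_nat mulKf.
split; last by exists b; rewrite yE mua sb /c; ring.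
exists (- a), h; rewrite -(ratr_int _ h) -hE yE mulrNz.
have -> : a%:~R = 2 * ratr mu :> R by rewrite mua mulrA divff ?mul1r.
by rewrite !(rmorphB, rmorphM, rmorphXn) /= ratr_nat -c2; ring.
Qed.

End ConjugateClosed.

(** * Spectral symmetry of twin vertices *)

Section TwinGraphs.
Variable R : realType.

Lemma char_poly_similar n (P A B : 'M[R]_n) : P \in unitmx ->
  P *m A = B *m P -> char_poly A = char_poly B.
Proof.
move=> Pu PA; pose PC := map_mx polyC P.
have detP : \det PC != 0.
  by rewrite det_map_mx polyC_eq0 -unitfE -unitmxE.
apply: (mulfI detP); rewrite [RHS]mulrC -!det_mulmx; congr (\det _).
by rewrite mulmxBr mulmxBl scalar_mxC -!map_mxM PA.
Qed.

Lemma symmetric_char_poly_split n (M : 'M[R]_n) : M^T = M ->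
  exists zs : seq R, char_poly M = \prod_(z <- zs) ('X - z%:P).
Proof.
move=> /symmetric_diagonalizable[P Pu /(diagonalizable_forLR Pu)[d ME]].
exists [seq d 0 i | i <- enum 'I_n].
have PM : P *m M = diag_mx d *m P by rewrite ME mxpoly.conjVmx// -mulmxA mulKVmx.
rewrite (char_poly_similar Pu PM).
rewrite char_poly_trig ?diag_mx_is_trig// big_map big_enum.
by apply: eq_bigr => i _; rewrite mxE eqxx.
Qed.

Variables (n : nat) (X : wgraph R n) (q : R).
Local Notation M := (Mq X q).

Lemma Mq_sym : M^T = M.
Proof. by rewrite /Mq linearD linearZ /= tr_diag_mx weight_sym. Qed.

Variables (omega eta : R) (T : {set 'I_n}) (u : 'I_n).
Hypothesis twinT : twin_family X omega eta T.
Hypothesis uT : u \in T.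
Local Notation theta := (q * degree X u + omega - eta).

Lemma weight_symE i j : X i j = X j i.
Proof. by rewrite -[in LHS](weight_sym X) mxE. Qed.

(** Twins are compared on common neighbors only; elsewhere both weights are nonnegative and not
    positive, hence 0. *)
Lemma twin_weight v j : v \in T -> j != u -> j != v -> X u j = X v j.
Proof.
move=> vT ju jv; have [<-//|uv] := eqVneq u v.
case: twinT => _ _ /(_ u v uT vT uv)[[Nuv wuv _] _].
have [jN|jN] := boolP (j \in neighbors X u :\: [set u; v]); first exact: wuv.
have jN' := jN; rewrite Nuv in jN'; move: jN jN'.
rewrite !inE !negb_or (negPf ju) (negPf jv) /= -!leNgt => Xu Xv.
by apply/eqP; rewrite eq_le (le_trans Xu) ?weight_ge0// (le_trans Xv) ?weight_ge0.
Qed.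

Lemma twin_degree v : v \in T -> degree X v = degree X u.
Proof.
move=> vT; have [->//|uv] := eqVneq v u.
have vu : u != v by rewrite eq_sym.
case: twinT => _ loop tw; rewrite /degree !loop//; congr (_ + _).
rewrite (bigD1 u) //= [RHS](bigD1 v) //= weight_symE; congr (_ + _).
under eq_bigl do rewrite andbC.
by apply: eq_bigr => j /andP[ju jv]; rewrite -twin_weight.
Qed.

Lemma twin_diff_eigen v : v \in T ->
  ((delta_mx 0 u - delta_mx 0 v : 'rV[R]_n) <= eigenspace M theta)%MS.
Proof.
move=> vT; have [->|uv] := eqVneq u v; first by rewrite subrr sub0mx.
have vu : v != u by rewrite eq_sym.
case: twinT => _ loop tw; have [_ Xuv] := tw u v uT vT uv.
apply/eigenspaceP/rowP => j; rewrite mulmxBl -!rowE.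
rewrite !mxE /=.
have [->|ju] := eqVneq j u.
  rewrite ?eqxx ?(negPf uv) ?(negPf vu) (loop u uT) [X v u]weight_symE Xuv.
  by rewrite mulr1n mulr0n mulr0 add0r /=; ring.
have [->|jv] := eqVneq j v.
  rewrite ?eqxx ?(negPf uv) ?(negPf vu) (loop v vT) Xuv (twin_degree vT).
  by rewrite mulr1n mulr0n mulr0 add0r /=; ring.
rewrite (twin_weight vT ju jv).
by rewrite !mulr0n !mulr0 /=; ring.
Qed.

(** The projection kills e_u - e_v, which lies in the theta-eigenspace. So its rows u and v agree,
    and by symmetry its two diagonal entries agree. *)
Lemma eigenproj_twin_neq v a : v \in T -> a != theta ->
  eigenproj M a v v = eigenproj M a u u.
Proof.
move=> vT ath.
have E0 : (delta_mx 0 u - delta_mx 0 v : 'rV[R]_n) *m eigenproj M a = 0.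
  by rewrite (eigenproj_neq Mq_sym _ (twin_diff_eigen vT))// eq_sym.
have rowE j : eigenproj M a u j = eigenproj M a v j.
  have := congr1 (fun A : 'rV[R]_n => A 0 j) E0.
  rewrite mulmxBl -!rowE [LHS]mxE [(- _ : 'rV_n) _ _]mxE ![row _ _ _ _]mxE [RHS]mxE.
  by move/eqP; rewrite subr_eq0 => /eqP.
have symE i j : eigenproj M a i j = eigenproj M a j i.
  by rewrite -[in LHS](eigenproj_sym M a) [(_^T) _ _]mxE.
by rewrite -rowE symE -rowE.
Qed.

Variables (rs : seq R).
Hypothesis rs_uniq : uniq rs.
Hypothesis rsE : \sum_(a <- rs) eigenproj M a = 1%:M.

Lemma eigenproj_twin v a : v \in T -> eigenproj M a v v = eigenproj M a u u.
Proof.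
move=> vT; have [->|] := eqVneq a theta; last exact: eigenproj_twin_neq.
have [thrs|thrs] := boolP (theta \in rs); last first.
  have : eigenproj M theta = 0.
    by apply/eqP; rewrite eigenproj_eq0; apply: contra thrs;
      exact: (mem_resolution Mq_sym rsE).
  by move=> ->; rewrite !mxE.
(* The remaining entry, at theta, is fixed by the total sum 1. *)
have := sum_eigenproj_diag rsE v; rewrite -(sum_eigenproj_diag rsE u).
rewrite (bigD1_seq theta)//= [RHS](bigD1_seq theta)//=.
rewrite (eq_bigr (fun a => eigenproj M a u u)); first by move/addIr.
by move=> b bth; exact: eigenproj_twin_neq.
Qed.

Lemma amplitude_twin v : v \in T -> amplitude M v = amplitude M u.
Proof.
move=> vT; apply/funext => t; rewrite !(amplitudeE _ _ Mq_sym rs_uniq rsE).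
by congr Normc.normc; apply: eq_bigr => a _; rewrite eigenproj_twin.
Qed.

End TwinGraphs.

(** * The diagonal entry of the theta-projection *)

Section Projections.
Variables (R : realType) (n : nat).

Lemma eigenproj_basis (M : 'M[R]_n) (a : R) k (B : 'M[R]_(k, n)) :
  orthonormal_rows B -> (B == eigenspace M a)%MS -> eigenproj M a = B^T *m B.
Proof.
move=> BB /eqmxP BV.
have EB : eigenproj M a *m (B^T *m B) = eigenproj M a.
  have /submxP[c ->] : (eigenproj M a <= B)%MS by rewrite BV eigenproj_sub.
  by rewrite -!mulmxA [B *m (_ *m _)]mulmxA BB mul1mx.
have BE : B^T *m B *m eigenproj M a = B^T *m B.
  by rewrite -mulmxA mul_eigenproj// BV.
have := congr1 trmx EB.
by rewrite trmx_mul [(B^T *m B)^T]trmx_mul trmxK !eigenproj_sym BE.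
Qed.

Lemma sum_outerE k (B : 'M[R]_(k, n)) : sum_outer B = B^T *m B.
Proof.
apply/matrixP => i j; rewrite summxE mxE; apply: eq_bigr => r _.
by rewrite mxE big_ord1 !mxE.
Qed.

(** Write e_u as 1/|T| times the sum of the e_u - e_v plus 1/|T| times the indicator of T. The first
    part lies in the span and the second is orthogonal to it, so the entry is (|T| - 1) / |T|. *)
Lemma twin_diff_projE k (B1 : 'M[R]_(k, n)) (T : {set 'I_n}) (u : 'I_n) :
  u \in T -> orthonormal_rows B1 -> (B1 == twin_diff_space R T u)%MS ->
  (B1^T *m B1) u u = 1 - #|T|%:R^-1.
Proof.
move=> uT B11 /eqmxP BD; pose e (v : 'I_n) : 'rV[R]_n := delta_mx 0 v.
have T0 : #|T|%:R != 0 :> R by rewrite pnatr_eq0 -lt0n; apply/card_gt0P; exists u.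
pose one := \sum_(v in T) e v.
have diffB v : v \in T -> (e u - e v <= B1)%MS.
  move=> vT; have [<-|uv] := eqVneq u v; first by rewrite subrr sub0mx.
  rewrite BD /twin_diff_space (sumsmx_sup v)// ?genmxE// in_setD1 vT andbT eq_sym//.
have oneB : one *m B1^T = 0.
  have /submxP[c ->] : (B1 <= twin_diff_space R T u)%MS by rewrite BD.
  rewrite trmx_mul mulmxA.
  suff -> : one *m (twin_diff_space R T u)^T = 0 by rewrite mul0mx.
  apply: trmx_inj; rewrite trmx_mul trmxK trmx0; apply/sub_kermxP.
  apply/sumsmx_subP => v; rewrite in_setD1 => /andP[vu vT]; rewrite genmxE.
  apply/sub_kermxP; rewrite mulmxBl -!rowE; apply/eqP; rewrite subr_eq0; apply/eqP.
  apply/rowP => j; rewrite !mxE !summxE.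
  have sumT x : x \in T -> \sum_(i in T) e i j x = 1.
    move=> xT; rewrite (bigD1 x) //= /e mxE ord1 !eqxx big1 ?addr0// => i /andP[_ ix].
    by rewrite mxE eq_sym (negPf ix) andbF.
  by rewrite !sumT.
have eE : e u = #|T|%:R^-1 *: (\sum_(v in T) (e u - e v)) + #|T|%:R^-1 *: one.
  rewrite -scalerDr sumrB subrK sumr_const -[e u *+ _]scaler_nat scalerA mulVf// scale1r.
  by [].
have EP : e u *m (B1^T *m B1) = #|T|%:R^-1 *: (\sum_(v in T) (e u - e v)).
  rewrite [in LHS]eE mulmxDl -!scalemxAl [one *m _]mulmxA oneB mul0mx scaler0 addr0.
  congr (_ *: _); rewrite mulmx_suml; apply: eq_bigr => v /diffB/submxP[c ->].
  by rewrite -mulmxA [B1 *m _]mulmxA B11 mul1mx.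
have := congr1 (fun A : 'rV[R]_n => A 0 u) EP; rewrite -rowE [LHS]mxE => ->.
rewrite [LHS]mxE summxE (bigD1 u)//= subrr mxE add0r.
rewrite (eq_bigr (fun=> 1)) => [|v /andP[_ vu]]; last first.
  by rewrite !mxE !eqxx eq_sym (negPf vu) subr0.
have -> : \sum_(i in T | i != u) (1 : R) = #|T|%:R - 1.
  have : \sum_(i in T) (1 : R) = #|T|%:R by rewrite sumr_const.
  by rewrite (bigD1 u)//= => <-; rewrite addrC addrK.
by rewrite mulrBr mulVf// mulr1.
Qed.

End Projections.

(** * The parity criterion for the infimum to equal the bound *)

Section Sharpness.
Variables (R : realType) (rs : seq R) (w : R -> R) (theta : R).
Hypothesis rs_uniq : uniq rs.
Hypothesis w_ge0 : forall a, 0 <= w a.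
Hypothesis w_sum : \sum_(a <- rs) w a = 1.
Hypothesis theta_rs : theta \in rs.

Local Notation amp t := (Normc.normc (char_sum rs w t)).
Local Notation bound := (2 * w theta - 1).
Local Notation s := [seq a <- rs | (a != theta) && (w a != 0)].

(** The parity condition of the theorem, over a finite list of the support without theta. *)
Definition even_relations : Prop := forall (m : int) (ell : R -> int),
  m%:~R * theta + \sum_(a <- s) (ell a)%:~R * a = 0 ->
  m + \sum_(a <- s) ell a = 0 -> (2 %| m)%Z.

(** A relation among the differences a - theta is a relation among theta and the a, with m minus the
    sum of the coefficients; so parity is the hypothesis of [kronecker_pi]. *)
Lemma amp_near_bound : 0 <= bound -> even_relations ->
  forall e, 0 < e -> exists2 t, 0 < t & amp t <= bound + e.
Proof.
move=> b0 evr e e0.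
pose mu (i : 'I_(size s)) := s`_i - theta.
have mu_even l : \sum_i (l i)%:~R * mu i = 0 -> (2 %| \sum_i l i)%Z.
  move=> lmu.
  pose ell a : int := if (insub (index a s) : option 'I_(size s)) is Some i then l i else 0.
  have s_uniq : uniq s by rewrite filter_uniq.
  have ellE (i : 'I_(size s)) : ell s`_i = l i.
    by rewrite /ell index_uniq// valK.
  have sumE (V : nmodType) (F : R -> V) : \sum_(a <- s) F a = \sum_(i < size s) F s`_i.
    by rewrite (big_nth 0) big_mkord.
  have rel1 : (- \sum_i l i)%:~R * theta + \sum_(a <- s) (ell a)%:~R * a = 0.
    rewrite sumE -[RHS]lmu mulrNz rmorph_sum /= mulNr mulr_suml addrC -sumrB.
    by apply: eq_bigr => i _; rewrite ellE /mu mulrBr.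
  have := evr _ _ rel1; rewrite sumE (eq_bigr _ (fun i _ => ellE i)) addNr.
  by move=> /(_ erefl); rewrite rpredN.
have e2 : 0 < e ^+ 2 / 2 by rewrite divr_gt0// exprn_gt0.
have [t t0 cost] := kronecker_pi mu_even e2.
exists t => //; apply: amp_le => //; first exact: ltW.
move=> a ars wa ath; have : a \in s by rewrite mem_filter ath wa.
move=> /(nthP 0)[i is_ <-].
by have := cost (Ordinal is_); rewrite /mu /= mulrC => /ltW.
Qed.

(** |sin| is subadditive, by the addition formula and |cos| <= 1. *)
Lemma sin_natmul_le (y : R) k : `|sin (k%:R * y)| <= k%:R * `|sin y|.
Proof.
elim: k => [|k IHk]; first by rewrite !mul0r sin0 normr0.
rewrite -natr1 !mulrDl !mul1r sinD; apply: le_trans (ler_normD _ _) _.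
rewrite !normrM; apply: lerD.
  by apply: le_trans IHk; rewrite ler_piMr// cos_max.
by rewrite ler_piMl// cos_max.
Qed.

Lemma sin_intmul_le (y : R) (k : int) : `|sin (k%:~R * y)| <= `|k|%:~R * `|sin y|.
Proof.
case: k => k; first exact: sin_natmul_le.
rewrite NegzE mulrNz mulNr sinN normrN normrN.
exact: sin_natmul_le.
Qed.

Lemma sin_sum_le (r : seq R) (k : R -> int) (y : R -> R) :
  `|sin (\sum_(a <- r) (k a)%:~R * y a)| <= \sum_(a <- r) `|k a|%:~R * `|sin (y a)|.
Proof.
elim: r => [|a r IHr]; first by rewrite !big_nil sin0 normr0.
rewrite !big_cons sinD; apply: le_trans (ler_normD _ _) _.
rewrite !normrM; apply: lerD.
  by apply: le_trans (sin_intmul_le _ _); rewrite ler_piMr// cos_max.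
by apply: le_trans IHr; rewrite ler_piMl// cos_max.
Qed.

Lemma sin_odd_half_pi (m : int) : ~~ (2 %| m)%Z -> `|sin (m%:~R * pi / 2)| = 1 :> R.
Proof.
move=> m2; have mo : odd `|m|%N by lia.
have c2 := cos_odd_mul_pi R mo.
have mE : m%:~R * pi = (m%:~R * pi / 2) *+ 2 :> R by rewrite mulr2n -splitr.
rewrite mE cos_mulr2n [X in X - 1]mulr2n in c2.
by apply/eqP; rewrite norm_sin_eq1 -sqrf_eq0; apply/eqP; lra.
Qed.

Lemma near_bound_even_relations :
  (forall e, 0 < e -> exists2 t, 0 < t & amp t < bound + e) -> even_relations.
Proof.
move=> near_b m ell rel1 rel2; apply: contrapT => /negP m2.
(* A positive lower bound on the weights turns a small total defect into a small defect of each
   angle. *)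
have [d d0 dw] : exists2 d, 0 < d & forall a, a \in s -> d <= w a.
  have ws a : a \in s -> 0 < w a.
    by rewrite mem_filter => /andP[/andP[_ wa] _]; rewrite lt0r wa w_ge0.
  elim: (s) ws => [|a r IHr] ws; first by exists 1.
  have [|d d0 dw] := IHr; first by move=> b br; apply: ws; rewrite inE br orbT.
  exists (Num.min d (w a)); first by rewrite lt_min d0 ws// mem_head.
  by move=> b; rewrite inE ge_min => /orP[/eqP ->|/dw ->]; rewrite ?lexx ?orbT.
pose L : R := \sum_(a <- s) `|ell a|%:~R.
have L0 : 0 <= L by apply: sumr_ge0 => a _; rewrite ler0z.
(* Chosen so that L h < 1, which contradicts |sin (m pi / 2)| = 1 for odd m. *)
pose h := (L + 1)^-1.
have h0 : 0 < h by rewrite invr_gt0 ltr_wpDl.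
have [t t0 tb] := near_b (2 * h ^+ 2 * d) ltac:(by rewrite !mulr_gt0// exprn_gt0).
(* |sin (y a)| is small when cos (t (a - theta)) is close to -1, whereas the
   relation forces sum_a (ell a) (y a) = - m pi / 2. *)
pose y a := (t * (a - theta) + pi) / 2.
have sy a : a \in s -> `|sin (y a)| <= h.
  move=> as_; have := as_; rewrite mem_filter => /andP[/andP[ath wa] ars].
  have A := amp_defect_term rs_uniq w_ge0 w_sum theta_rs t ars ath.
  have cosy : cos (t * (a - theta)) = 2 * sin (y a) ^+ 2 - 1.
    have := cosDpi (t * (a - theta)); rewrite (splitr (_ + pi)) -mulr2n cos_mulr2n.
    by rewrite -/(y a) cos2sin2; lra.
  rewrite cosy in A.
  rewrite -(ger0_norm (ltW h0)) -ler_sqr ?nnegrE// !real_normK ?num_real//.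
  rewrite -(ler_pM2l d0); apply: (@le_trans _ _ (w a * sin (y a) ^+ 2)).
    by rewrite ler_wpM2r ?sqr_ge0// dw.
  lra.
have := sin_sum_le s ell y.
have -> : \sum_(a <- s) (ell a)%:~R * y a = - (m%:~R * pi / 2).
  have -> : \sum_(a <- s) (ell a)%:~R * y a =
    t / 2 * (\sum_(a <- s) (ell a)%:~R * a) +
    (pi - t * theta) / 2 * (\sum_(a <- s) ell a)%:~R.
    rewrite rmorph_sum /= !mulr_sumr -big_split /=; apply: eq_bigr => a _.
    by rewrite /y; field.
  have -> : \sum_(a <- s) (ell a)%:~R * a = - (m%:~R * theta).
    by apply/eqP; rewrite -addr_eq0 addrC rel1.
  have -> : \sum_(a <- s) ell a = - m by apply/eqP; rewrite -addr_eq0 addrC rel2.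
  by rewrite mulrNz; field.
rewrite sinN normrN sin_odd_half_pi//; apply/negP; rewrite -ltNge.
apply: (@le_lt_trans _ _ (L * h)).
  rewrite /L mulr_suml big_seq [leRHS]big_seq; apply: ler_sum => a as_.
  by rewrite ler_wpM2l ?ler0z// sy.
by rewrite /h ltr_pdivrMr ?mul1r ?ltrDl// ltr_wpDl.
Qed.

End Sharpness.

(** * A common time for equal 2-adic valuations *)

Section Attainment.
Variable R : realType.

(** At t = pi / (2^k sqrt D) the angle is c pi / 2^k, an odd multiple of pi because 2^k is the exact
    power of 2 in c. *)
Lemma equal_val2_time (S : set R) (theta : R) (D : nat) :
  (0 < D)%N -> equal_val2 S theta D ->
  exists2 t, 0 < t & forall a, S a -> a != theta -> cos (t * (a - theta)) = -1.
Proof.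
move=> D0 [k kP]; have sD : 0 < Num.sqrt D%:R :> R by rewrite sqrtr_gt0 ltr0n.
exists (pi / (2 ^+ k * Num.sqrt D%:R)).
  by rewrite divr_gt0 ?pi_gt0// mulr_gt0// exprn_gt0.
move=> a Sa ath; have [c cE lc] := kP _ Sa ath.
have c0 : (0 < absz c)%N.
  rewrite absz_gt0; apply: contraNneq ath => c0; rewrite -subr_eq0.
  by move: cE; rewrite c0 => /eqP; rewrite mulf_eq0 invr_eq0 (gt_eqF sD) orbF.
have [//|j j2 cj] := @pfactor_coprime 2 (absz c) _ c0.
rewrite lc in cj.
have -> : pi / (2 ^+ k * Num.sqrt D%:R) * (a - theta) = (c%:~R * pi) / 2 ^+ k :> R.
  by rewrite -cE; field; rewrite (gt_eqF sD) expf_neq0 ?pnatr_eq0.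
rewrite -cos_norm normrM (gtr0_norm (_ : 0 < (2 ^+ k)^-1)) ?invr_gt0 ?exprn_gt0//.
rewrite normrM (gtr0_norm (pi_gt0 R)) -intr_norm -abszE cj.
have -> : (j * 2 ^ k)%N%:Z%:~R * pi / 2 ^+ k = j%:Z%:~R * pi :> R.
  rewrite -[LHS]/((j * 2 ^ k)%N%:R * pi / 2 ^+ k) natrM natrX -[in RHS]/(j%:R * pi).
  by field; rewrite expf_neq0.
by apply: cos_odd_mul_pi; rewrite /= -coprime2n.
Qed.

End Attainment.

(** * Bounds for the infimum of the amplitude *)

Lemma inf_amplitude_ge (R : realType) n (M : 'M[R]_n) v (c : R) :
  (forall t, c <= amplitude M v t) -> c <= inf_amplitude M v.
Proof.
move=> cle; apply: lb_le_inf; first by exists (amplitude M v 1); exists 1 => //; exact: ltr01.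
by move=> _ [t _ <-].
Qed.

Lemma inf_amplitude_le (R : realType) n (M : 'M[R]_n) v (c t : R) :
  (forall t, c <= amplitude M v t) -> 0 < t -> inf_amplitude M v <= amplitude M v t.
Proof.
move=> cle t0; apply: ge_inf; last by exists t.
by exists c => _ [x _ <-].
Qed.

Lemma expi_eqN1_sym (R : realType) (t a b : R) :
  expi (t * (a - b)) = -1 <-> cos (t * (b - a)) = -1.
Proof. by rewrite expi_eqN1 -[b - a]opprB mulrN cosN. Qed.

(** * Sedentariness of twin vertices, from the spectral and arithmetic results *)

Theorem theorem15 (R : realType) (n : nat) (X : wgraph R n) (q omega eta : R)
    (T : {set 'I_n}) (u : 'I_n)
    (k l : nat) (B1 : 'M[R]_(k, n)) (B2 : 'M[R]_(l, n)) :
  let M := Mq X q in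
  let theta := q * degree X u + omega - eta in
  let E := eigenproj M theta in
  let F := sum_outer B2 in
  let sigma := esupport M u in
  let bound := 1 - 2 / #|T|%:R + 2 * F u u in
  let cond_i := exists Delta : nat, integral_form sigma Delta in
  let cond_i_ii := exists Delta : nat,
    integral_form sigma Delta /\ equal_val2 sigma theta Delta in
  twin_set X omega eta T ->
  u \in T ->
  orthonormal_rows B1 ->
  (B1 == twin_diff_space R T u)%MS ->
  orthonormal_rows (col_mx B1 B2) ->
  (col_mx B1 B2 == eigenspace M theta)%MS ->
  [/\ [/\ eigenvalue M theta,
          2 * E u u - 1 = bound,
          forall t : R, bound <= amplitude M u t
        & forall t : R, amplitude M u t = bound <->
            (forall lambda, sigma lambda -> lambda != theta ->
               expi (t * (theta - lambda)) = -1)],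
      (0 < bound ->
        ((char_poly M \is a polyOver Num.int) ->
         (forall v, v \in T -> periodic_vertex M v) ->
         exists C : R,
           [/\ forall v, v \in T -> tightly_sedentary M C v,
               cond_i_ii -> C = bound
             & ~ cond_i_ii -> cond_i \/ conj_closed sigma -> bound < C])
        /\
        ((forall v, v \in T -> ~ periodic_vertex M v) ->
         ((forall v, v \in T -> sharply_sedentary M bound v) <->
          (forall (m : int) (ell : R -> int),
             m%:~R * theta
               + \sum_(lambda \in (sigma `\ theta)%classic)
                    (ell lambda)%:~R * lambda = 0 ->
             m + \sum_(lambda \in (sigma `\ theta)%classic) ell lambda = 0 ->
             (2 %| m)%Z)))),
      ((3 <= #|T|)%N -> forall v, v \in T -> sedentary M bound v)
    & forall v : 'I_n, T = [set u; v]%SET ->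
        forall w : 'rV[R]_n,
          w != 0 ->
          (w <= eigenspace M theta)%MS ->
          ~~ (w <= (delta_mx 0 u - delta_mx 0 v : 'rV[R]_n))%MS ->
          (w 0 u != 0) || (w 0 v != 0) ->
          (forall x, x \in T -> 2 * F u u <= inf_amplitude M x) /\
          (w 0 u + w 0 v != 0 ->
             forall x, x \in T -> sedentary M (2 * F u u) x)].
Proof.
move=> M theta E F sigma bound cond_i cond_i_ii [twinT _] uT oB1 B1E oB BE.
have Msym : M^T = M := Mq_sym X q.
have [rs rs_uniq rsE] := spectral_resolution Msym.
pose w a := eigenproj M a u u.
have w_ge0 a : 0 <= w a by exact: eigenproj_diag_ge0.
have w_sum : \sum_(a <- rs) w a = 1 by exact: sum_eigenproj_diag.
have [T2 _ _] := twinT.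
have T_gt0 : 0 < #|T|%:R :> R by rewrite ltr0n (leq_trans _ T2).
have EuuE : E u u = 1 - #|T|%:R^-1 + F u u.
  rewrite /E (eigenproj_basis oB BE) tr_col_mx mul_row_col mxE.
  by rewrite (twin_diff_projE uT oB1 B1E) /F sum_outerE.
have F_ge0 : 0 <= F u u.
  by rewrite /F sum_outerE mxE; apply: sumr_ge0 => i _; rewrite mxE -expr2 sqr_ge0.
have boundE : 2 * w theta - 1 = bound by rewrite /w -/E EuuE /bound; ring.
(* Since |T| >= 2 the bound is nonnegative, as the equality criterion requires. *)
have TV : #|T|%:R^-1 <= 2^-1 :> R by rewrite lef_pV2 ?posrE// ler_nat.
have bound0 : 0 <= bound by rewrite /bound; lra.
have bound0' : 0 <= 2 * w theta - 1 by rewrite boundE.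
have wth_neq0 : w theta != 0 by rewrite gt_eqF//; lra.
have sigmaE a : sigma a <-> w a != 0 by exact: esupportE.
have sigma_eig a : sigma a -> eigenvalue M a by case.
have sigma_rs a : sigma a -> a \in rs by move/sigma_eig; exact: mem_resolution.
have sigma_theta : sigma theta by apply/sigmaE.
have theta_rs : theta \in rs by exact: sigma_rs.
have wth_le1 : w theta <= 1.
  by rewrite -w_sum (bigD1_seq theta)//= lerDl; apply: sumr_ge0 => a _.
have bound_le1 : bound <= 1 by rewrite -boundE; lra.
have ampE t : amplitude M u t = Normc.normc (char_sum rs w t).
  exact: amplitudeE.
(* Every claim about a vertex of T thereby reduces to u. *)
have ampT x : x \in T -> amplitude M x = amplitude M u.
  by move=> xT; apply: (amplitude_twin twinT uT rs_uniq rsE).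
have infT x : x \in T -> inf_amplitude M x = inf_amplitude M u.
  by move=> xT; rewrite /inf_amplitude ampT.
have bound_le t : bound <= amplitude M u t.
  by rewrite ampE -boundE; apply: bound_le_amp.
have bound_inf : bound <= inf_amplitude M u by exact: inf_amplitude_ge.
have inf_le t : 0 < t -> inf_amplitude M u <= amplitude M u t.
  by apply: inf_amplitude_le; exact: bound_le.
have inf_le1 : inf_amplitude M u <= 1.
  by apply: le_trans (inf_le 1 ltr01) _; rewrite ampE amp_le1.
have amp_boundP t : amplitude M u t = bound <->
    (forall a, sigma a -> a != theta -> cos (t * (a - theta)) = -1).
  rewrite ampE -boundE amp_eq//; split=> cosP a.
    by move=> sa; apply: cosP; [exact: sigma_rs | exact/sigmaE].
  by move=> _ /sigmaE; exact: cosP.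
have sed_bound : 0 < bound -> forall x, x \in T -> sedentary M bound x.
  by move=> b0 x xT; split; rewrite ?b0//= infT.
split.
- split=> //; first exact: sigma_eig.
  + by move=> t; rewrite amp_boundP; split=> cosP a sa ath;
      move: (cosP a sa ath); rewrite expi_eqN1_sym.
- move=> b0; split.
    move=> char_int per; have [tau tau0 tau1] := per u uT.
    rewrite ampE in tau1.
    have [t0 t00 t0min] := amp_min_attained w_ge0 w_sum tau0 tau1.
    have infE : inf_amplitude M u = amplitude M u t0.
      apply/eqP; rewrite eq_le inf_le//=; apply: lb_le_inf.
        by exists (amplitude M u 1); exists 1 => //; exact: ltr01.
      by move=> _ [t /= t_gt0 <-]; rewrite !ampE t0min.
    exists (inf_amplitude M u); split.
    + move=> x xT; split; last by exists t0; rewrite // ampT.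
      by split; rewrite ?infT// inf_le1 (lt_le_trans b0).
    + move=> [D [form val]].
      have [D0 _] := integral_form_diff form sigma_theta.
      have [t t_gt0 /amp_boundP tb] := equal_val2_time D0 val.
      by apply/eqP; rewrite eq_le bound_inf andbT -tb inf_le.
    + move=> ncond cond; rewrite lt_neqAle bound_inf andbT.
      apply/negP => /eqP bE; apply: ncond.
      have cosP := (amp_boundP t0).1 (etrans (esym infE) (esym bE)).
      (* The bound is attained at [t0], so the angles are odd multiples of pi; once (i) holds, (ii)
         follows from this. *)
      suff [D form] : cond_i.
        exists D; split=> //.
        have [D0 diff] := integral_form_diff form sigma_theta.
        exact: equal_val2_of_odd D0 t00 cosP diff.
      case: cond => // cc.
      have [PZ PZE] := floorpP char_int.
      have [zs zsE] := symmetric_char_poly_split Msym.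
      have PZmon : PZ \is monic.
        have := char_poly_monic M; rewrite PZE !monicE lead_coef_map_inj//; last exact: intr_inj.
        by rewrite (inj_eq (@intr_inj R) _ 1).
      have root_sigma x : sigma x -> root (map_poly (intr : int -> R) PZ) x.
        by move=> /sigma_eig; rewrite eigenvalue_root_char PZE.
      (* Odd multiples of pi at time [t0] place the support in an arithmetic progression of step pi
         / t0. *)
      apply: (@conj_closed_integral_form R sigma theta (pi / t0) PZ zs) => //.
        by rewrite -PZE.
      move=> x sx; have [->|xth] := eqVneq x theta; first by exists 0; rewrite mul0r addr0.
      have [j jE] := cos_eqN1 (cosP x sx xth).
      exists (2 * j + 1); rewrite mulrA -jE.
      by field; rewrite gt_eqF.
  move=> _.
  pose s := [seq a <- rs | (a != theta) && (w a != 0)].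
  have s_uniq : uniq s by rewrite filter_uniq.
  have sE : (sigma `\ theta = [set` s])%classic.
    apply/seteqP; split=> a /=.
      move=> [sa ath]; rewrite mem_filter sigma_rs// andbT.
      by apply/andP; split; [exact/eqP | exact/sigmaE].
    rewrite mem_filter => /andP[/andP[ath wa] _].
    by split; [exact/sigmaE | exact/eqP].
  have relE : even_relations rs w theta <-> (forall (m : int) (ell : R -> int),
      m%:~R * theta + \sum_(a \in (sigma `\ theta)%classic) (ell a)%:~R * a = 0 ->
      m + \sum_(a \in (sigma `\ theta)%classic) ell a = 0 -> (2 %| m)%Z).
    by split=> H m ell; have := H m ell; rewrite sE -!fsbig_seq.
  rewrite -relE; split.
    move=> /(_ u uT)[_ infE]; apply: (near_bound_even_relations rs_uniq) => // e e0.
    have [] := @inf_adherent R [set amplitude M u t | t in [set t : R | 0 < t]]%classic e e0.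
      split; first by exists (amplitude M u 1); exists 1 => //; exact: ltr01.
      by exists bound => _ [t _ <-].
    move=> _ [t t_gt0 <-]; rewrite -/(inf_amplitude M u) infE ampE -boundE => tb.
    by exists t.
  move=> evr x xT; split; first by rewrite b0.
  rewrite infT//; apply/eqP; rewrite eq_le bound_inf andbT.
  apply/ler_addgt0Pr => e e0.
  have [t t_gt0 tb] := amp_near_bound rs_uniq w_ge0 w_sum theta_rs bound0' evr e0.
  by apply: le_trans (inf_le t t_gt0) _; rewrite ampE -boundE.
- move=> T3; apply: sed_bound; rewrite /bound.
  have : #|T|%:R^-1 <= 3^-1 :> R by rewrite lef_pV2 ?posrE// ler_nat.
  lra.
- move=> v TE z z0 zth _ _.
  have vT : v \in T by rewrite TE !inE eqxx orbT.
  have uv : u != v.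
    by apply/eqP => uv; move: T2; rewrite TE uv finset.setUid cards1.
  have cT : #|T| = 2%N by rewrite TE cards2 uv.
  have b2F : bound = 2 * F u u by rewrite /bound cT divff ?subrr ?add0r// pnatr_eq0.
  rewrite -b2F; split; first by move=> x xT; rewrite infT.
  move=> zuv; apply: sed_bound; rewrite b2F mulr_gt0// lt0r F_ge0 andbT.
  (* If F_uu = 0, every vector z of the eigenspace satisfies z_u + z_v = 0: the rows of [B2] vanish
     at u, hence also at v by orthogonality to e_u - e_v, and those of [B1] are multiples of e_u -
     e_v. *)
  apply: contra zuv => /eqP F0.
  have diffB : ((delta_mx 0 u - delta_mx 0 v : 'rV[R]_n) <= B1)%MS.
    move/eqmxP: B1E => ->; rewrite /twin_diff_space (sumsmx_sup v) ?genmxE//.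
    by rewrite !inE eq_sym uv vT.
  have B12 : B1 *m B2^T = 0.
    move: oB; rewrite /orthonormal_rows tr_col_mx mul_col_row scalar_mx_block.
    by case/eq_block_mx.
  have B2u i : B2 i u = 0.
    move: F0; rewrite /F sum_outerE mxE => /eqP; rewrite psumr_eq0 => [/allP|j _]; last first.
      by rewrite mxE -expr2 sqr_ge0.
    by move=> /(_ i); rewrite mem_index_enum mxE mulf_eq0 orbb => /(_ isT)/eqP.
  have B2v i : B2 i v = 0.
    have /submxP[c dE] := diffB.
    have := congr1 (fun A : 'rV[R]_n => (A *m B2^T) 0 i) dE.
    rewrite -mulmxA B12 mulmx0 mulmxBl -!rowE [RHS]mxE.
    rewrite [LHS]mxE [(- _ : 'rV_l) _ _]mxE ![row _ _ _ _]mxE ![(B2^T) _ _]mxE B2u.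
    by rewrite sub0r => /eqP; rewrite oppr_eq0 => /eqP.
  have B1uv i : B1 i u + B1 i v = 0.
    have /row_subP/(_ i) : (B1 <= (delta_mx 0 u - delta_mx 0 v : 'rV[R]_n))%MS.
      move/eqmxP: B1E => ->; apply/sumsmx_subP => x; rewrite genmxE in_setD1 TE !inE.
      by move=> /andP[xu]; rewrite (negPf xu) /= => /eqP ->; exact: submx_refl.
    move=> /sub_rVP[c rE].
    have := congr1 (fun A : 'rV[R]_n => A 0 u + A 0 v) rE; rewrite ![row _ _ _ _]mxE => ->.
    have vu : v != u by rewrite eq_sym.
    by rewrite !mxE !eqxx /= (negPf uv) (negPf vu) /=; ring.
  have /submxP[c ->] : (z <= col_mx B1 B2)%MS by move/eqmxP: BE => ->.
  rewrite -[c]hsubmxK mul_row_col; set c1 := lsubmx c; set c2 := rsubmx c.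
  have zE j : (c1 *m B1 + c2 *m B2) 0 j =
      \sum_i c1 0 i * B1 i j + \sum_i c2 0 i * B2 i j by rewrite !mxE.
  rewrite !zE [X in _ + X + _]big1 => [|i _]; last by rewrite B2u mulr0.
  rewrite [X in _ + (_ + X)]big1 => [|i _]; last by rewrite B2v mulr0.
  rewrite !addr0 -big_split big1//= => i _.
  by rewrite -mulrDr B1uv mulr0.
Qed.
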